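(* Let $R$ be a commutative ring containing $\mathbb{Z}[y^{\pm1}]$ as a subring, let $\alpha_n(D;y)\in R$ ($D$ an unoriented link diagram, $n\in\mathbb Z$) be coefficient polynomials satisfying properties (1)–(3) listed in the context, and for each unoriented link diagram $D$ put $$L_D(y,z)=z^{1-r(D)}\sum_{n\ge 0}\alpha_n(D;y)z^n .$$ If $D$ and $D'$ are regularly isotopic diagrams, then $L_D=L_{D'}$. Moreover, for all skein quadruples $(D_+,D_-,D_\infty,D_0)$, $$L_{D_+}+L_{D_-}=z\,(L_{D_\infty}+L_{D_0});$$ if $D^{+}$ (respectively $D^{-}$) is obtained from $D$ by adding a positive (respectively negative) kink, then $$L_{D^{+}}=y\,L_D,\qquad L_{D^{-}}=y^{-1}L_D;$$ and $L_{O}=1$ for the zero-crossing knot diagram $O$.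
   Context: An unoriented link diagram is a generic immersion of a finite nonempty disjoint union of circles in the plane, with over/under information at each crossing; diagrams are considered up to planar isotopy. $r(D)$ is the number of components of $D$. Two diagrams are regularly isotopic if they are related by a finite sequence of planar isotopies and Reidemeister moves of types II and III. Kinks: a kink is a one-crossing curl added to a strand by a Reidemeister move of type I; it is positive (negative) if its crossing has sign $+1$ ($-1$) for some, equivalently any, orientation of the strand. Skein quadruple: $D_+$ and $D_-$ agree outside a small disk and inside it consist of a single crossing $p$, the two differing by a crossing change at $p$ (the labels $+,-$ are assigned via an auxiliary local orientation); $D_{p1}=D_\infty$ and $D_{p2}=D_0$ are the two diagrams obtained by replacing the crossing by its two planar smoothings. $\Delta(pi)=r(D_{pi})-r(D)$ for $i=1,2$, where $D=D_+$ or $D_-$ (note $r(D_+)=r(D_-)$). Properties of the coefficient polynomials, for all $n\in\mathbb Z$: (1) $\alpha_n(D;y)$ is invariant under Reidemeister moves of types II and III, and $\alpha_n(D^{+};y)=y\,\alpha_n(D;y)$, $\alpha_n(D^{-};y)=y^{-1}\alpha_n(D;y)$ when $D^{\pm}$ is obtained from $D$ by adding a positive/negative kink. (2) $\alpha_n(O;y)=\delta_{n,0}$. (3) $\alpha_n(D_+;y)+\alpha_n(D_-;y)=\alpha_{n+\Delta(p1)-1}(D_{p1};y)+\alpha_{n+\Delta(p2)-1}(D_{p2};y)$ for every skein quadruple. $L_D$ is regarded as a formal Laurent series in $z$ with coefficients in $R$. *)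

(* Defs.v *)
From Stdlib Require Export Relation_Operators.
From HB Require Import structures.
From mathcomp Require Export all_boot all_order all_algebra.
From mathcomp Require Import boolp.

Set Implicit Arguments.
Unset Strict Implicit.
Unset Printing Implicit Defensive.

Import Order.TTheory GRing.Theory Num.Theory.

(* Link diagrams in the plane, read from bottom to top along a generic height
   function.  Such a diagram is a word of elementary slices; the slice (e, i)
   puts the elementary piece e just to the right of i vertical strands (any
   number of vertical strands may follow on its right).
   [Cross true]: the strand going from bottom left to top right is the upper
   one; [Cross false]: the strand going from bottom right to top left is. If
   both strands are oriented upwards, these crossings have sign +1 and -1. *)

Inductive piece := Cup | Cap | Cross of bool.

Definition slice : Type := (piece * nat)%type.
Definition word := seq slice.

Definition ins (e : piece) : nat := if e is Cup then 0 else 2.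
Definition outs (e : piece) : nat := if e is Cap then 0 else 2.

Definition step_width (n : nat) (a : slice) : nat := n - ins a.1 + outs a.1.

Fixpoint tangle (n : nat) (w : word) (m : nat) : bool :=
  if w is a :: w' then (a.2 + ins a.1 <= n) && tangle (step_width n a) w' m
  else n == m.

Record diagram := Diagram {
  diagram_word :> word;
  diagramP : ~~ nilp diagram_word && tangle 0 diagram_word 0 }.

HB.instance Definition _ := [isSub for diagram_word].

Definition O_diagram : diagram := @Diagram [:: (Cup, 0); (Cap, 0)] isT.

(* Number of components: connected components of the set of points (k, i),
   the i-th strand from the left at level k, where level k lies between
   slices k - 1 and k. *)

Definition width (w : word) (k : nat) : nat := foldl step_width 0 (take k w).

Definition points (w : word) : seq (nat * nat) :=
  [seq (k, i) | k <- iota 0 (size w).+1, i <- iota 0 (width w k)].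

Definition passes (a : slice) (i j : nat) : bool :=
  let: (e, p) := a in
  [|| (i < p) && (j == i),
      (p + ins e <= i) && (j == i - ins e + outs e)
    | if e is Cross _
      then ((i == p) && (j == p.+1)) || ((i == p.+1) && (j == p)) else false].

Definition turns (a : slice) (i j : nat) : bool := (i == a.2) && (j == a.2.+1).

Definition slice_at (w : word) (k : nat) : slice := nth (Cup, 0) w k.

Definition joined (w : word) (x y : nat * nat) : bool :=
  let: (k, i) := x in let: (l, j) := y in
  [|| [&& k < size w, l == k.+1 & passes (slice_at w k) i j],
      [&& k < size w, l == k &
        if (slice_at w k).1 is Cap then turns (slice_at w k) i j else false]
    | [&& 0 < k, l == k &
        if (slice_at w k.-1).1 is Cup then turns (slice_at w k.-1) i j
        else false]].

Definition components (D : diagram) : nat :=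
  n_comp [rel x y : seq_sub (points D) |
           joined D (val x) (val y) || joined D (val y) (val x)] predT.

(* Planar isotopy is generated by the codimension one events met by the height
   function: two slices exchange their heights, a maximum and a minimum are
   born or cancel, or one branch has a horizontal tangent at a crossing. *)

Inductive planar_move : word -> word -> Prop :=
| exchange (a b : piece) (i j : nat) : i <= j ->
    planar_move [:: (a, i); (b, j + outs a)] [:: (b, j + ins a); (a, i)]
| zigzag_left (i : nat) : planar_move [:: (Cup, i); (Cap, i.+1)] [::]
| zigzag_right (i : nat) : planar_move [:: (Cup, i.+1); (Cap, i)] [::]
| cross_cap (s : bool) (i : nat) :
    planar_move [:: (Cross s, i); (Cap, i.+1)]
                [:: (Cross (~~ s), i.+1); (Cap, i)]
| cross_cup (s : bool) (i : nat) :
    planar_move [:: (Cup, i.+1); (Cross s, i)]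
                [:: (Cup, i); (Cross (~~ s), i.+1)].

Inductive reidemeister2 : word -> word -> Prop :=
| R2 (s : bool) (i : nat) :
    reidemeister2 [:: (Cross s, i); (Cross (~~ s), i)] [::].

(* In the left-hand word, strand 1 passes over strand 2 iff s, over strand 3
   iff t, and strand 2 passes over strand 3 iff u.  The side condition says
   that these relations are not cyclic, i.e. that some strand lies above the
   other two. *)
Inductive reidemeister3 : word -> word -> Prop :=
| R3 (s t u : bool) (i : nat) : (s == t) || (t == u) ->
    reidemeister3 [:: (Cross s, i); (Cross t, i.+1); (Cross u, i)]
                  [:: (Cross u, i.+1); (Cross t, i); (Cross s, i.+1)].

Definition local_move (move : word -> word -> Prop) (D D' : diagram) : Prop :=
  exists u t t' v : word,
    [/\ move t t', D = u ++ t ++ v :> word & D' = u ++ t' ++ v :> word].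

Definition planar_isotopic : diagram -> diagram -> Prop :=
  clos_refl_sym_trans diagram (local_move planar_move).

Definition regular_isotopic : diagram -> diagram -> Prop :=
  clos_refl_sym_trans diagram (fun D D' =>
    [\/ local_move planar_move D D', local_move reidemeister2 D D'
      | local_move reidemeister3 D D']).

Definition drawn_as (D : diagram) (w : word) : Prop :=
  exists2 E : diagram, planar_isotopic D E & E = w :> word.

(* A curl on the strand number i, to its right or to its left.  Both passages
   of the strand through the crossing go upwards, so the sign of the crossing
   is +1 for [Cross true] and -1 for [Cross false]. *)
Definition curl (right s : bool) (i : nat) : word :=
  if right then [:: (Cup, i.+1); (Cross s, i); (Cap, i.+1)]
  else [:: (Cup, i); (Cross s, i.+1); (Cap, i)].

(* D' is obtained from D by adding a kink, positive if s and negative if not. *)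
Definition adds_kink (s : bool) (D D' : diagram) : Prop :=
  exists (u v : word) (i : nat) (right : bool),
    drawn_as D (u ++ v) /\ drawn_as D' (u ++ curl right s i ++ v).

(* Without orientations neither the labels +, - nor the labels oo, 0 of the two
   smoothings are intrinsic: every labelling is allowed. *)
Definition skein_quadruple (Dp Dm Doo D0 : diagram) : Prop :=
  exists (u v : word) (i : nat) (s : bool),
    let vertical := u ++ v in
    let horizontal := u ++ [:: (Cap, i); (Cup, i)] ++ v in
    [/\ drawn_as Dp (u ++ [:: (Cross s, i)] ++ v),
        drawn_as Dm (u ++ [:: (Cross (~~ s), i)] ++ v)
      & (drawn_as Doo vertical /\ drawn_as D0 horizontal) \/
        (drawn_as Doo horizontal /\ drawn_as D0 vertical)].

Local Open Scope ring_scope.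

Definition Delta (D D' : diagram) : int :=
  (components D')%:Z - (components D)%:Z.

(* The ring Z[y, y^-1], as a subring of the fraction field of Z[y]. *)

Notation Zfrac := {fraction {poly int}}.

Definition fracX : Zfrac := FracField.tofrac 'X.

Definition is_laurent : {pred Zfrac} :=
  fun f => `[< exists (p : {poly int}) (n : nat),
               f = FracField.tofrac p / fracX ^+ n >].

Lemma fracX_neq0 : fracX != 0.
Proof. by rewrite /fracX tofrac_eq0 polyX_eq0. Qed.

Lemma is_laurent_subring : subring_closed is_laurent.
Proof.
have hX n : fracX ^+ n != 0 by rewrite expf_neq0 // fracX_neq0.
split.
- by apply/asboolP; exists 1, 0%N; rewrite tofrac1 expr0 divr1.
- move=> f g /asboolP[p [n ->]] /asboolP[q [m ->]]; apply/asboolP.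
  exists (p * 'X ^+ m - q * 'X ^+ n), (n + m)%N.
  rewrite tofracB !tofracM !tofracXn -/fracX mulrBl exprD invfM.
  congr (_ - _); first by rewrite mulrACA divff ?mulr1.
  by rewrite [_^-1 * _]mulrC mulrACA divff ?mulr1.
- move=> f g /asboolP[p [n ->]] /asboolP[q [m ->]]; apply/asboolP.
  by exists (p * q), (n + m)%N; rewrite tofracM exprD invfM mulrACA.
Qed.

HB.instance Definition _ :=
  GRing.isSubringClosed.Build Zfrac is_laurent is_laurent_subring.

Record Zlaurent := MkZlaurent {
  Zlaurent_val : Zfrac;
  ZlaurentP : Zlaurent_val \in is_laurent }.

HB.instance Definition _ := [isSub for Zlaurent_val].
HB.instance Definition _ := [Choice of Zlaurent by <:].
HB.instance Definition _ := [SubChoice_isSubComNzRing of Zlaurent by <:].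

Lemma laurentX_subproof : fracX \in is_laurent.
Proof. by apply/asboolP; exists 'X, 0%N; rewrite expr0 divr1. Qed.

Lemma laurentXV_subproof : fracX^-1 \in is_laurent.
Proof. by apply/asboolP; exists 1, 1%N; rewrite tofrac1 expr1 mul1r. Qed.

Definition Zy : Zlaurent := MkZlaurent laurentX_subproof.
Definition ZyV : Zlaurent := MkZlaurent laurentXV_subproof.

Lemma ZyK : Zy * ZyV = 1.
Proof. by apply: val_inj; rewrite /= divff // fracX_neq0. Qed.

(* Formal Laurent series in z over R: coefficients vanish in low degrees. *)

Record lseries (R : comNzRingType) := LSeries {
  lcoef :> int -> R;
  lcoefP : exists N : int, forall k, k < N -> lcoef k = 0 }.

Section LaurentSeries.
Variable R : comNzRingType.
Implicit Types f g : lseries R.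

Lemma lseriesP f g : lcoef f =1 lcoef g -> f = g.
Proof.
case: f g => [f Hf] [g Hg] /= /funext E.
by case: _ / E in Hg *; congr LSeries; exact: Prop_irrelevance.
Qed.

HB.instance Definition _ := gen_eqMixin (lseries R).
HB.instance Definition _ := gen_choiceMixin (lseries R).

Lemma lzero_subproof : exists N : int, forall k, k < N -> 0 = 0 :> R.
Proof. by exists 0. Qed.
Definition lzero := LSeries lzero_subproof.

Lemma lopp_subproof f : exists N : int, forall k, k < N -> - f k = 0.
Proof. by case: (lcoefP f) => N H; exists N => k /H ->; rewrite oppr0. Qed.
Definition lopp f := LSeries (lopp_subproof f).

Lemma ladd_subproof f g : exists N : int, forall k, k < N -> f k + g k = 0.
Proof.
case: (lcoefP f) (lcoefP g) => N Hf [M Hg]; exists (Num.min N M) => k.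
by rewrite lt_min => /andP[/Hf -> /Hg ->]; rewrite addr0.
Qed.
Definition ladd f g := LSeries (ladd_subproof f g).

Lemma lscale_subproof (c : R) f : exists N : int, forall k, k < N -> c * f k = 0.
Proof. by case: (lcoefP f) => N H; exists N => k /H ->; rewrite mulr0. Qed.
Definition lscale (c : R) f := LSeries (lscale_subproof c f).

Lemma laddA : associative ladd.
Proof. by move=> f g h; apply: lseriesP => k /=; rewrite addrA. Qed.
Lemma laddC : commutative ladd.
Proof. by move=> f g; apply: lseriesP => k /=; rewrite addrC. Qed.
Lemma ladd0 : left_id lzero ladd.
Proof. by move=> f; apply: lseriesP => k /=; rewrite add0r. Qed.
Lemma laddN : left_inverse lzero lopp ladd.
Proof. by move=> f; apply: lseriesP => k /=; rewrite addNr. Qed.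

HB.instance Definition _ :=
  GRing.isZmodule.Build (lseries R) laddA laddC ladd0 laddN.

Lemma lscaleA (a b : R) f : lscale a (lscale b f) = lscale (a * b) f.
Proof. by apply: lseriesP => k /=; rewrite mulrA. Qed.
Lemma lscale1 : left_id 1 lscale.
Proof. by move=> f; apply: lseriesP => k /=; rewrite mul1r. Qed.
Lemma lscaleDr : right_distributive lscale +%R.
Proof. by move=> a f g; apply: lseriesP => k /=; rewrite mulrDr. Qed.
Lemma lscaleDl f : {morph lscale^~ f : a b / a + b}.
Proof. by move=> a b; apply: lseriesP => k /=; rewrite mulrDl. Qed.

HB.instance Definition _ := GRing.Zmodule_isLmodule.Build R (lseries R)
  lscaleA lscale1 lscaleDr lscaleDl.

(* the series sum_(n >= 0) a n * z ^ n *)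
Lemma lpower_subproof (a : nat -> R) : exists N : int, forall k, k < N ->
  (if k is Posz n then a n else 0) = 0.
Proof. by exists 0; case. Qed.
Definition lpower (a : nat -> R) : lseries R := LSeries (lpower_subproof a).

(* the product z ^ m * f *)
Lemma zmul_subproof (m : int) f :
  exists N : int, forall k, k < N -> f (k - m) = 0.
Proof.
case: (lcoefP f) => N H; exists (N + m) => k Hk.
by apply: H; rewrite ltrBlDr.
Qed.
Definition zmul (m : int) f : lseries R := LSeries (zmul_subproof m f).

(* the series 1 *)
Definition lone : lseries R := lpower (fun n => (n == 0)%:R).

End LaurentSeries.

(* alpha n D stands for alpha_n(D; y) *)
Definition L (R : comNzRingType) (alpha : int -> diagram -> R) (D : diagram) :
  lseries R :=
  zmul (1 - (components D)%:Z) (lpower (fun n : nat => alpha n%:Z D)).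

(* Main.v *)
(* Reading off the coefficient of z ^ k turns every claimed identity into one of
   the assumed identities for alpha, once two facts are known: the number of
   components is invariant under the moves, and alpha_n = 0 for n < 0, which
   makes the truncation n >= 0 in L harmless.

   Vanishing is proved by reducing diagrams.  The words on which all alpha_n with
   n < 0 vanish are closed under the moves and kinks; under the skein relation,
   because a smoothing creates at most one component; and under adding a circle,
   because of the skein relation at a kink.  Reading a word from the bottom, one
   keeps its lower part in a normal form in which the arcs are stacked, each arc
   passing over all the arcs that end to its left.  Stacking a cup, a cap or a
   crossing on a normal form gives, up to the skein relation, normal forms again;
   as crossings can be switched freely, only the convenient sign of a crossing
   has to be treated.

   Components are counted by transfer matrices: 2 ^ components is the number of
   two-colourings of the diagram constant on components, and this number is
   computed slice by slice.  The colourings form a vector space over F_2, in which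
   requiring two strands to agree defines a subspace of index at most two; this
   bounds the number of components of a smoothing. *)

Require Import Defs.
From mathcomp Require Import all_boot all_order all_algebra zify.

Set Implicit Arguments.
Unset Strict Implicit.
Unset Printing Implicit Defensive.

(** * Moves of tangle words *)

Lemma tangle_cat n u v m :
  tangle n (u ++ v) m =
  tangle n u (foldl step_width n u) && tangle (foldl step_width n u) v m.
Proof. by elim: u n => [|a u IH] n /=; rewrite ?eqxx // IH andbA. Qed.

Lemma tangle_width n w m : tangle n w m -> foldl step_width n w = m.
Proof. by elim: w n => [|a w IH] n /=; [move/eqP | case/andP=> _ /IH]. Qed.

Lemma tangle_catP n u v m :
  tangle n (u ++ v) m <-> exists2 k, tangle n u k & tangle k v m.
Proof.
rewrite tangle_cat; split; first by case/andP; exists (foldl step_width n u).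
by case=> k hu; rewrite (tangle_width hu) hu.
Qed.

(** Curls count as moves here: a kink leaves the number of components unchanged and multiplies every
    [alpha n] by a unit, so it does not affect vanishing either. *)
Inductive elementary : word -> word -> Prop :=
| elementary_planar t t' of planar_move t t' : elementary t t'
| elementary_R2 t t' of reidemeister2 t t' : elementary t t'
| elementary_R3 t t' of reidemeister3 t t' : elementary t t'
| elementary_curl right s i : elementary (curl right s i) [::].

Definition rewrites (n m : nat) (w w' : word) : Prop :=
  [/\ tangle n w m, tangle n w' m
    & exists u t t' v, [/\ elementary t t', w = u ++ t ++ v & w' = u ++ t' ++ v]].

Definition sim (n m : nat) := clos_refl_sym_trans word (rewrites n m).

Lemma sim_tangle n m w w' : sim n m w w' -> tangle n w m = tangle n w' m.
Proof. by elim=> [x y [-> ->]|x|x y _ ->|x y z _ -> _ ->]. Qed.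

Lemma sim_cat n m k l u v w w' : tangle k u n -> tangle m v l ->
  sim n m w w' -> sim k l (u ++ w ++ v) (u ++ w' ++ v).
Proof.
move=> hu hv; elim=> [x y [hx hy [a [t [t' [b [tt' ex ey]]]]]]|x|x y _|x y z _ h1 _ h2].
- apply: rst_step; split.
  + by apply/tangle_catP; exists n; last (apply/tangle_catP; exists m).
  + by apply/tangle_catP; exists n; last (apply/tangle_catP; exists m).
  + by exists (u ++ a), t, t', (b ++ v); rewrite ex ey -!catA.
- exact: rst_refl.
- exact: rst_sym.
- exact: rst_trans h1 h2.
Qed.

(* Not symmetric: inserting a pair of slices is only possible where there are
   enough strands, so a converse needs [w'] to be the word known to be valid. *)
Variant conv (w w' : word) : Prop :=
  Conv of forall n m, tangle n w m -> sim n m w w'.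

Lemma conv_refl w : conv w w.
Proof. by constructor=> n m _; apply: rst_refl. Qed.

Lemma conv_trans w2 w1 w3 : conv w1 w2 -> conv w2 w3 -> conv w1 w3.
Proof.
move=> [h12] [h23]; constructor=> n m h; have h1 := h12 _ _ h.
by apply: rst_trans (h1) _; apply: h23; rewrite -(sim_tangle h1).
Qed.

Lemma conv_mid u v w w' : conv w w' -> conv (u ++ w ++ v) (u ++ w' ++ v).
Proof.
move=> [h]; constructor=> n m /tangle_catP[k hu /tangle_catP[l hw hv]].
exact: sim_cat hu hv (h _ _ hw).
Qed.

Lemma conv_catl u w w' : conv w w' -> conv (u ++ w) (u ++ w').
Proof. by move/(@conv_mid u [::]); rewrite !cats0. Qed.

Lemma conv_catr v w w' : conv w w' -> conv (w ++ v) (w' ++ v).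
Proof. exact: (@conv_mid [::]). Qed.

Lemma conv_elementary t t' :
  elementary t t' -> (forall n m, tangle n t m -> tangle n t' m) -> conv t t'.
Proof.
move=> tt' valid; constructor=> n m ht; apply: rst_step; split=> //; first exact: valid.
by exists [::], t, t', [::]; rewrite !cats0.
Qed.

Lemma conv_elementary_sym t t' :
  elementary t t' -> (forall n m, tangle n t' m -> tangle n t m) -> conv t' t.
Proof.
move=> tt' valid; constructor=> n m ht.
apply/rst_sym/rst_step; split=> //; first exact: valid.
by exists [::], t, t', [::]; rewrite !cats0.
Qed.

Ltac tangle_lia := rewrite /= /step_width /=; lia.

Section Elementary.
Variables (a b : piece) (s t u : bool) (i j : nat).

Lemma conv_exchange : i <= j ->
  conv [:: (a, i); (b, j + outs a)] [:: (b, j + ins a); (a, i)].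
Proof.
move=> ij; apply: conv_elementary; first by do 2 constructor.
by move=> n m; case: a b => [||?] [||?]; tangle_lia.
Qed.

Lemma conv_exchange_sym : i <= j ->
  conv [:: (b, j + ins a); (a, i)] [:: (a, i); (b, j + outs a)].
Proof.
move=> ij; apply: conv_elementary_sym; first by do 2 constructor.
by move=> n m; case: a b => [||?] [||?]; tangle_lia.
Qed.

Lemma conv_zigzag_left : conv [:: (Cup, i); (Cap, i.+1)] [::].
Proof.
by apply: conv_elementary; [do 2 constructor | move=> n m; tangle_lia].
Qed.

Lemma conv_zigzag_right : conv [:: (Cup, i.+1); (Cap, i)] [::].
Proof.
by apply: conv_elementary; [do 2 constructor | move=> n m; tangle_lia].
Qed.

Lemma conv_R2 : conv [:: (Cross s, i); (Cross (~~ s), i)] [::].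
Proof.
by apply: conv_elementary; [do 2 constructor | move=> n m; tangle_lia].
Qed.

Lemma conv_R3_sym : (s == t) || (t == u) ->
  conv [:: (Cross u, i.+1); (Cross t, i); (Cross s, i.+1)]
       [:: (Cross s, i); (Cross t, i.+1); (Cross u, i)].
Proof.
move=> stu; apply: conv_elementary_sym; last by move=> n m; tangle_lia.
by apply: elementary_R3; constructor.
Qed.

Lemma conv_cap :
  conv [:: (Cross s, i); (Cap, i.+1)] [:: (Cross (~~ s), i.+1); (Cap, i)].
Proof.
by apply: conv_elementary; [do 2 constructor | move=> n m; tangle_lia].
Qed.

Lemma conv_cap_sym :
  conv [:: (Cross s, i.+1); (Cap, i)] [:: (Cross (~~ s), i); (Cap, i.+1)].
Proof.
rewrite -{1}[s]negbK.
apply: conv_elementary_sym; first by do 2 constructor.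
by move=> n m; tangle_lia.
Qed.

Lemma conv_cup :
  conv [:: (Cup, i.+1); (Cross s, i)] [:: (Cup, i); (Cross (~~ s), i.+1)].
Proof.
by apply: conv_elementary; [do 2 constructor | move=> n m; tangle_lia].
Qed.

Lemma conv_cup_sym :
  conv [:: (Cup, i); (Cross s, i.+1)] [:: (Cup, i.+1); (Cross (~~ s), i)].
Proof.
rewrite -{1}[s]negbK.
apply: conv_elementary_sym; first by do 2 constructor.
by move=> n m; tangle_lia.
Qed.

Lemma conv_curl right : conv (curl right s i) [::].
Proof.
by apply: conv_elementary; [constructor | case: right => n m; tangle_lia].
Qed.

End Elementary.

Lemma conv_sym w w' :
  conv w' w -> (forall n m, tangle n w m -> tangle n w' m) -> conv w w'.
Proof. by move=> [h] valid; constructor=> n m /valid /h; apply: rst_sym. Qed.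

Ltac conv_at u v h :=
  let k := fresh in
  have k := conv_mid u v h; rewrite -?catA /= ?cats0 in k; exact: k.

(** A kink at a maximum is a curl on the left leg of the cap in disguise: [w] becomes the bare cap
    when the curl is removed, and becomes the kink by planar moves alone, which flip the sign of the
    crossing. *)
Lemma conv_cap_kink s i : conv [:: (Cross s, i); (Cap, i)] [:: (Cap, i)].
Proof.
pose w := curl false (~~ s) i ++ [:: (Cap, i)].
have w_cap : conv w [:: (Cap, i)].
  exact: (conv_catr [:: (Cap, i)] (conv_curl (~~ s) i false)).
have w_kink : conv w [:: (Cross s, i); (Cap, i)].
  apply: (@conv_trans [:: (Cup, i); (Cross (~~ s), i.+1); (Cap, i.+2); (Cap, i)]).
    have h := conv_exchange Cap Cap (leqnn i); rewrite addn0 addn2 in h.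
    conv_at [:: (Cup, i); (Cross (~~ s), i.+1)] ([::] : word) h.
  apply: (@conv_trans [:: (Cup, i); (Cross s, i.+2); (Cap, i.+1); (Cap, i)]).
    have h := conv_cap (~~ s) i.+1; rewrite negbK in h.
    conv_at [:: (Cup, i)] [:: (Cap, i)] h.
  apply: (@conv_trans [:: (Cross s, i); (Cup, i); (Cap, i.+1); (Cap, i)]).
    have h := conv_exchange Cup (Cross s) (leqnn i); rewrite addn0 addn2 in h.
    conv_at ([::] : word) [:: (Cap, i.+1); (Cap, i)] h.
  conv_at [:: (Cross s, i)] [:: (Cap, i)] (conv_zigzag_left i).
apply: conv_trans w_cap; apply: conv_sym w_kink _ => n m.
by rewrite /w; tangle_lia.
Qed.

Lemma conv_cup_kink s i : conv [:: (Cup, i); (Cross s, i)] [:: (Cup, i)].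
Proof.
pose w := (Cup, i) :: curl false (~~ s) i.
have w_cup : conv w [:: (Cup, i)].
  exact: (conv_catl [:: (Cup, i)] (conv_curl (~~ s) i false)).
have w_kink : conv w [:: (Cup, i); (Cross s, i)].
  apply: (@conv_trans [:: (Cup, i); (Cup, i.+2); (Cross (~~ s), i.+1); (Cap, i)]).
    have h := conv_exchange_sym Cup Cup (leqnn i); rewrite addn0 addn2 in h.
    conv_at ([::] : word) [:: (Cross (~~ s), i.+1); (Cap, i)] h.
  apply: (@conv_trans [:: (Cup, i); (Cup, i.+2); (Cross s, i); (Cap, i.+1)]).
    have h := conv_cap_sym (~~ s) i; rewrite negbK in h.
    conv_at [:: (Cup, i); (Cup, i.+2)] ([::] : word) h.
  apply: (@conv_trans [:: (Cup, i); (Cross s, i); (Cup, i.+2); (Cap, i.+1)]).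
    have h := conv_exchange_sym (Cross s) Cup (leqnn i); rewrite addn2 in h.
    conv_at [:: (Cup, i)] [:: (Cap, i.+1)] h.
  conv_at [:: (Cup, i); (Cross s, i)] ([::] : word) (conv_zigzag_right i.+1).
apply: conv_trans w_cup; apply: conv_sym w_kink _ => n m.
by rewrite /w; tangle_lia.
Qed.

(** * Arcs passing over the other strands *)

Definition X (i : nat) : slice := (Cross false, i).

(* The strand number j + l moves to position j, passing over the l strands
   that it meets. *)
Fixpoint over (j l : nat) : word :=
  if l is l'.+1 then X (j + l') :: over j l' else [::].

Lemma over_cat j l k : over j (l + k) = over (j + k) l ++ over j k.
Proof. by elim: l => //= l ->; rewrite -addnA [k + l]addnC. Qed.

Lemma over_rcons j l : over j l.+1 = over j.+1 l ++ [:: X j].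
Proof. by rewrite -addn1 over_cat /= addn0 addn1. Qed.

Lemma tangle_over n j l m :
  tangle n (over j l) m = (n == m) && ((l == 0) || (j + l < n)).
Proof.
by elim: l n => [|l IH] n /=; rewrite ?andbT // IH /step_width /=; lia.
Qed.

Definition shift (d : nat) (w : word) : word := [seq (a.1, a.2 + d) | a <- w].

Lemma shift_over d j l : shift d (over j l) = over (j + d) l.
Proof. by elim: l => //= l ->; rewrite /X addnAC. Qed.

Lemma conv_slide_left a i w : all (fun b => i <= b.2) w ->
  conv (shift (ins a) w ++ [:: (a, i)]) ((a, i) :: shift (outs a) w).
Proof.
elim: w => [|[b k] w IH] /=; first by move=> _; apply: conv_refl.
case/andP=> ik /IH h.
apply: (@conv_trans ((b, k + ins a) :: (a, i) :: shift (outs a) w)).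
  exact: (conv_catl [:: (b, k + ins a)] h).
exact: (conv_catr (shift (outs a) w) (conv_exchange_sym a b ik)).
Qed.

Lemma conv_over_slice j l (a : slice) : j + l < a.2 ->
  conv (over j l ++ [:: a]) (a :: over j l).
Proof.
case: a => b k /=; elim: l => [|l IH] jlk /=; first exact: conv_refl.
apply: (@conv_trans (X (j + l) :: (b, k) :: over j l)).
  by apply: (conv_catl [:: X (j + l)]); apply: IH; lia.
have jlk2 : j + l <= k - 2 by lia.
have h := conv_exchange (Cross false) b jlk2; rewrite subnK in h; last by lia.
exact: (conv_catr (over j l) h).
Qed.

Lemma conv_over_cross j l i : j <= i -> i.+1 < j + l ->
  conv (over j l ++ [:: X i.+1]) (X i :: over j l).
Proof.
move=> ji; elim: l => [|l IH] il /=; first by lia.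
have [il'|] := boolP (i.+1 < j + l).
  apply: (@conv_trans (X (j + l) :: X i :: over j l)).
    exact: (conv_catl [:: X (j + l)] (IH il')).
  have ijl : i <= j + l - 2 by lia.
  have h := conv_exchange_sym (Cross false) (Cross false) ijl.
  rewrite subnK in h; last by lia.
  exact: (conv_catr (over j l) h).
move=> il'; case: l IH il il' => [|l] _ il il'; first by lia.
have ei : i = j + l by lia.
rewrite {}ei addnS /=.
apply: (@conv_trans [:: X (j + l).+1, X (j + l), X (j + l).+1 & over j l]).
  by apply: (conv_catl [:: X (j + l).+1; X (j + l)]); apply: conv_over_slice.
exact: (conv_catr (over j l) (@conv_R3_sym false false false (j + l) isT)).
Qed.

Lemma conv_cross_over j l i : j <= i -> i.+1 < j + l ->
  conv (X i :: over j l) (over j l ++ [:: X i.+1]).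
Proof.
move=> ji il; apply: conv_sym; first exact: conv_over_cross.
move=> n m; rewrite -cat1s => /tangle_catP[k].
rewrite /= tangle_over /step_width /= => hk ho.
apply/tangle_catP; exists n; rewrite ?tangle_over /= /step_width /=; lia.
Qed.

(** The second moving strand starts to the right of all crossings of the first and ends to their
    left, so it passes over each of them in turn. *)
Lemma conv_over_over j e k l : k <= j -> j + e < k + l ->
  conv (over j e ++ over k l) (over k l ++ over j.+1 e).
Proof.
move=> kj; elim: e => [|e IH] el /=; first by rewrite cats0; apply: conv_refl.
apply: (@conv_trans (X (j + e) :: over k l ++ over j.+1 e)).
  by apply: (conv_catl [:: X (j + e)]); apply: IH; lia.
have h : conv (X (j + e) :: over k l) (over k l ++ [:: X (j + e).+1]).
  by apply: conv_cross_over; lia.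
by have := conv_catr (over j.+1 e) h; rewrite -catA.
Qed.

(** A strand crossing over both legs of a fresh cup can be pulled off it. *)
Lemma conv_cup_pass i : conv [:: (Cup, i); X i.+1; X i] [:: (Cup, i.+1)].
Proof.
apply: (@conv_trans [:: (Cup, i.+1); (Cross true, i); (Cross false, i)]).
  exact: (conv_catr [:: X i] (conv_cup_sym false i)).
exact: (conv_catl [:: (Cup, i.+1)] (conv_R2 true i)).
Qed.

Lemma conv_over_cup j l i : j <= i < j + l ->
  conv (over j l ++ [:: (Cup, i.+1)]) ((Cup, i) :: over j l.+2).
Proof.
elim: l => [|l IH] ijl; first by lia.
have [il|il] := ltnP i (j + l).
  apply: (@conv_trans (X (j + l) :: (Cup, i) :: over j l.+2)).
    by apply: (conv_catl [:: X (j + l)]); apply: IH; lia.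
  have h := conv_exchange_sym Cup (Cross false) (ltnW il).
  rewrite addn0 addn2 in h.
  rewrite -[over j l.+3]/(X (j + l.+2) :: over j l.+2) !addnS.
  exact: (conv_catr (over j l.+2) h).
have ei : i = j + l by lia.
rewrite {}ei {il ijl} /=.
apply: (@conv_trans [:: X (j + l), (Cup, (j + l).+1) & over j l]).
  by apply: (conv_catl [:: X (j + l)]); apply: conv_over_slice.
apply: (@conv_trans [:: X (j + l), (Cup, j + l), X (j + l).+1, X (j + l) & over j l]).
  have h : conv [:: (Cup, (j + l).+1)] [:: (Cup, j + l); X (j + l).+1; X (j + l)].
    by apply: conv_sym (conv_cup_pass _) _ => n m; tangle_lia.
  exact: (conv_mid [:: X (j + l)] (over j l) h).
rewrite !addnS.
have h := conv_exchange_sym Cup (Cross false) (leqnn (j + l)).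
rewrite addn0 addn2 in h.
exact: (conv_catr [:: X (j + l).+1, X (j + l) & over j l] h).
Qed.

Lemma conv_over_cap j l i : j < i <= (j + l).+1 ->
  conv (over j l.+2 ++ [:: (Cap, i)]) ((Cap, i.-1) :: over j l).
Proof.
elim: l => [|l IH] ijl.
  have -> : i = j.+1 by lia.
  rewrite /= addn0 addn1.
  apply: (@conv_trans [:: X j.+1; (Cross true, j.+1); (Cap, j)]).
    exact: (conv_catl [:: X j.+1] (conv_cap false j)).
  exact: (conv_catr [:: (Cap, j)] (conv_R2 false j.+1)).
have [il|il] := leqP i (j + l).+1.
  apply: (@conv_trans (X (j + l.+2) :: (Cap, i.-1) :: over j l)).
    by apply: (conv_catl [:: X (j + l.+2)]); apply: IH; lia.
  have il' : i.-1 <= j + l by lia.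
  have h := conv_exchange_sym Cap (Cross false) il'.
  rewrite addn0 addn2 in h.
  by rewrite !addnS; apply: (conv_catr (over j l) h).
have ei : i = (j + l).+2 by lia.
rewrite {}ei {il ijl IH} -[over j l.+3]/([:: X (j + l.+2); X (j + l.+1)] ++ over j l.+1).
rewrite !addnS /=.
apply: (@conv_trans [:: X (j + l).+2, X (j + l).+1, (Cap, (j + l).+2) & over j l.+1]).
  apply: (conv_catl [:: X (j + l).+2; X (j + l).+1]).
  by apply: (@conv_over_slice j l.+1); rewrite addnS.
apply: (@conv_trans
  [:: X (j + l).+2, (Cross true, (j + l).+2), (Cap, (j + l).+1) & over j l.+1]).
  exact: (conv_mid [:: X (j + l).+2] (over j l.+1) (conv_cap false (j + l).+1)).
exact: (conv_catr ((Cap, (j + l).+1) :: over j l.+1) (conv_R2 false (j + l).+2)).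
Qed.

(** The strand number i moves to position i + l; the l strands that it meets go under it. *)
Definition under (i l : nat) : word := [seq (Cross true, k) | k <- iota i l].

(** The strand number i, the cap and the arc form a long zigzag lying above the other strands;
    pulled tight, it is a single strand moving right above them. *)
Lemma conv_cup_over_cap i l :
  conv ((Cup, i.+1 + l) :: over i.+1 l ++ [:: (Cap, i)]) (under i l).
Proof.
elim: l i => [|l IH] i; first by rewrite addn0; apply: conv_zigzag_right.
rewrite over_rcons -catA /=.
apply: (@conv_trans
  ((Cup, i.+1 + l.+1) :: over i.+2 l ++ [:: (Cross true, i); (Cap, i.+1)])).
  have := conv_catl ((Cup, i.+1 + l.+1) :: over i.+2 l) (conv_cap_sym false i).
  by rewrite -?catA.
apply: (@conv_trans
  ((Cross true, i) :: (Cup, i.+2 + l) :: over i.+2 l ++ [:: (Cap, i.+1)])); last first.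
  exact: (conv_catl [:: (Cross true, i)] (IH i.+1)).
have h := @conv_slide_left (Cross true) i ((Cup, i + l) :: over i l).
rewrite /= shift_over in h.
have {}h := conv_catr [:: (Cap, i.+1)] (h _).
rewrite /= !addn2 -catA in h; rewrite addnS; apply: h.
by rewrite leq_addr /=; elim: (l) => //= l' ->; rewrite leq_addr.
Qed.

(** The first crossing of the moving leg forms, with the cup and the cap, a curl on the strand
    number j + l; without it that strand just moves to j. *)
Lemma conv_cup_over_cap_last j l :
  conv ((Cup, (j + l).+1) :: over j l.+1 ++ [:: (Cap, (j + l).+1)]) (over j l).
Proof.
apply: (@conv_trans [:: (Cup, (j + l).+1), X (j + l), (Cap, (j + l).+1) & over j l]).
  by apply: (conv_catl [:: (Cup, (j + l).+1); X (j + l)]); apply: conv_over_slice.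
exact: (conv_catr (over j l) (conv_curl false (j + l) true)).
Qed.

Lemma conv_over_slices j l (w : word) : all (fun a => j + l < a.2) w ->
  conv (over j l ++ w) (w ++ over j l).
Proof.
elim: w => [|a w IH] /=; first by rewrite cats0 => _; apply: conv_refl.
case/andP=> ha /IH h; apply: (@conv_trans (a :: over j l ++ w)).
  by have := conv_catr w (conv_over_slice ha); rewrite -catA.
exact: (conv_catl [:: a] h).
Qed.

Definition arc (j l : nat) : word := (Cup, j + l) :: over j l.

Lemma tangle_arc j l : tangle (j + l) (arc j l) (j + l).+2.
Proof. by rewrite /= tangle_over /step_width /=; lia. Qed.

Section NestedArcs.
Variables (k j l e n : nat).
Hypotheses (kj : k <= j) (kl : k + l = n) (je : j + e = n).

(* The inner arc (n+1, n+2) and the outer arc (n, n+3) have their left legs moved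
   to j+1 and k. *)
Let nested : word := [:: (Cup, n); (Cup, n.+1)] ++ over k l ++ over j.+1 e.

(** Together with [conv_arcs_nested]: crossing the right ends of two stacked arcs has the effect of
    exchanging the arcs in the stack, as both pictures reduce to [nested]. *)
Lemma conv_arcs_cross :
  conv (arc k l ++ arc j.+1 e.+1 ++ [:: X n.+2]) nested.
Proof.
rewrite /arc /= kl !addSn !addnS je.
apply: (@conv_trans
  ((Cup, n) :: over k l ++ [:: (Cup, n.+2); X n.+1; X n.+2] ++ over j.+1 e)).
  have h : conv (over j.+1 e ++ [:: X n.+2]) (X n.+2 :: over j.+1 e).
    by apply: conv_over_slice; rewrite addSn je.
  have := conv_catl ((Cup, n) :: over k l ++ [:: (Cup, n.+2); X n.+1]) h.
  by rewrite /= -!catA.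
apply: (@conv_trans
  ([:: (Cup, n); (Cup, n.+2); X n.+1; X n.+2] ++ over k l ++ over j.+1 e)).
  have h : conv (over k l ++ [:: (Cup, n.+2); X n.+1; X n.+2])
                ([:: (Cup, n.+2); X n.+1; X n.+2] ++ over k l).
    by apply: conv_over_slices; rewrite /= kl; lia.
  have := conv_mid [:: (Cup, n)] (over j.+1 e) h.
  by rewrite /= -!catA.
apply: (@conv_trans
  ([:: (Cup, n); (Cup, n.+1); (Cross true, n.+2); X n.+2] ++ over k l ++ over j.+1 e)).
  exact: (conv_mid [:: (Cup, n)] (X n.+2 :: over k l ++ over j.+1 e)
            (conv_cup false n.+1)).
exact: (conv_mid [:: (Cup, n); (Cup, n.+1)] (over k l ++ over j.+1 e)
          (conv_R2 true n.+2)).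
Qed.

Lemma conv_arcs_nested : conv (arc j e ++ arc k l.+2) nested.
Proof.
rewrite /arc /= !addnS kl je.
apply: (@conv_trans ([:: (Cup, n); (Cup, n.+2); X n.+1] ++ over j e ++ over k l.+1)).
  have h : conv (over j e ++ [:: (Cup, n.+2); X n.+1])
                ([:: (Cup, n.+2); X n.+1] ++ over j e).
    by apply: conv_over_slices; rewrite /= je; lia.
  have := conv_mid [:: (Cup, n)] (over k l.+1) h.
  by rewrite /= -!catA /= kl.
apply: (@conv_trans ([:: (Cup, n); (Cup, n.+2); X n.+1] ++ over k l.+1 ++ over j.+1 e)).
  by apply/conv_catl/conv_over_over; lia.
apply: (@conv_trans ([:: (Cup, n); (Cup, n); X n.+1] ++ over k l.+1 ++ over j.+1 e)).
  have h := conv_exchange Cup Cup (leqnn n); rewrite addn0 addn2 in h.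
  exact: (conv_catr (X n.+1 :: over k l.+1 ++ over j.+1 e) h).
rewrite /= kl.
exact: (conv_mid [:: (Cup, n)] (over k l ++ over j.+1 e) (conv_cup_pass n)).
Qed.

End NestedArcs.

(** * Reduction to stacked arcs *)

(** The properties of vanishing used by the reduction. A circle is allowed only next to some strand,
    on which a kink can be drawn; the empty word is no diagram, but serves as the normal form
    without strands. *)
Record skein_closed (V : word -> Prop) : Prop := {
  closed_sim : forall w w', sim 0 0 w w' -> V w' -> V w;
  closed_skein : forall u v i s,
    tangle 0 (u ++ [:: (Cross s, i)] ++ v) 0 ->
    V (u ++ [:: (Cross (~~ s), i)] ++ v) -> V (u ++ v) ->
    V (u ++ [:: (Cap, i); (Cup, i)] ++ v) ->
    V (u ++ [:: (Cross s, i)] ++ v);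
  closed_circle : forall u v n, 0 < n -> tangle 0 u n -> tangle n v 0 ->
    V (u ++ v) -> V (u ++ [:: (Cup, n); (Cap, n)] ++ v);
  closed_nil : V [::];
  closed_O : V [:: (Cup, 0); (Cap, 0)] }.

(* The arc added last has its right end on the last strand, and passes over all
   the others. *)
Inductive normal : nat -> word -> Prop :=
| normal_nil : normal 0 [::]
| normal_arc j l T : normal (j + l) T -> normal (j + l).+2 (T ++ arc j l).

Lemma normal_tangle n T : normal n T -> tangle 0 T n.
Proof.
elim=> [//|j l {}T _ IH]; apply/tangle_catP; exists (j + l) => //.
exact: tangle_arc.
Qed.

Variant normal_spec n T : Prop :=
| NormalNil of n = 0 & T = [::]
| NormalArc j l T' of n = (j + l).+2 & T = T' ++ arc j l & normal (j + l) T'.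

Lemma normalP n T : normal n T -> normal_spec n T.
Proof. by case=> [|j l T']; [left | move=> h; apply: NormalArc h]. Qed.

(** * Stacking cups, caps and crossings on normal forms *)

Section Reduction.
Variable V : word -> Prop.
Hypothesis closedV : skein_closed V.

(* On every closure, x is determined by normal words as far as V can see. *)
Definition reducible (n : nat) (x : word) : Prop :=
  forall v, tangle n v 0 -> (forall T, normal n T -> V (T ++ v)) -> V (x ++ v).

Lemma reducible_normal n T : normal n T -> reducible n T.
Proof. by move=> nT v _; apply. Qed.

Lemma reducible_sim n x x' : sim 0 n x x' -> reducible n x' -> reducible n x.
Proof.
move=> xx' rx' v hv hT; apply: closed_sim (rx' v hv hT) => //.
exact: (sim_cat (u := [::]) _ hv xx').
Qed.

Lemma reducible_conv k n T t t' : normal k T -> conv t t' -> tangle k t n ->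
  reducible n (T ++ t') -> reducible n (T ++ t).
Proof.
move=> nT [tt'] ht; apply: reducible_sim.
have := sim_cat (normal_tangle nT) (_ : tangle n [::] n) (tt' _ _ ht).
by rewrite !cats0; apply; rewrite /=.
Qed.

(** A reducible lower part may be replaced by normal words, so that each new slice has to be studied
    on normal words only. *)
Lemma reducible_cat k n x t : reducible k x -> tangle k t n ->
  (forall T, normal k T -> reducible n (T ++ t)) -> reducible n (x ++ t).
Proof.
move=> rx ht rT v hv hV; rewrite -catA; apply: rx.
  by apply/tangle_catP; exists n.
by move=> T nT; rewrite catA; apply: rT.
Qed.

Lemma reducible_arc j l x :
  reducible (j + l) x -> reducible (j + l).+2 (x ++ arc j l).
Proof.
move=> rx; apply: (reducible_cat rx (tangle_arc j l)) => T nT.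
by apply: reducible_normal; constructor.
Qed.

Lemma leq_positions_over i j l : i <= j -> all (fun b => i <= b.2) (over j l).
Proof. by move=> ij; elim: l => //= l ->; lia. Qed.

Lemma conv_arc_slide a i j l : i <= j ->
  conv (arc (j + ins a) l ++ [:: (a, i)]) ((a, i) :: arc (j + outs a) l).
Proof.
move=> ij; have h := @conv_slide_left a i (arc j l).
rewrite /= !shift_over ![j + l + _]addnAC in h; apply: h.
by rewrite leq_positions_over //; lia.
Qed.

Lemma reducible_cup n T i : normal n T -> i <= n -> reducible n.+2 (T ++ [:: (Cup, i)]).
Proof.
move=> nT; elim: nT i => [|j l {}T nT IH] i.
  rewrite leqn0 => /eqP->.
  by apply: reducible_normal; apply: (@normal_arc 0 0); constructor.
move=> il; have [->|il'] := eqVneq i (j + l).+2.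
  apply: reducible_normal; rewrite -[(j + l).+2]addn0.
  by apply: (@normal_arc _ 0); rewrite addn0; constructor.
have harc k : tangle (j + l) (arc j l ++ [:: (Cup, i)]) k = (k == (j + l).+4).
  rewrite tangle_cat (tangle_width (tangle_arc j l)) tangle_arc /= /step_width /=.
  by lia.
(* A cup to the left of the top arc slides below it; any other cup is pulled below the moving leg,
   which then has two more strands to cross. *)
rewrite -catA; have [ij|ji] := leqP i j.
  have h := conv_arc_slide Cup l ij; rewrite addn0 in h.
  apply: (reducible_conv nT h); first by rewrite harc.
  have := @reducible_arc (j + 2) l (T ++ [:: (Cup, i)]).
  rewrite addn2 !addSn -catA; apply; apply: IH; lia.
case: i ji il il' harc => // i ji il il' harc.
have h : conv (arc j l ++ [:: (Cup, i.+1)]) ((Cup, i) :: arc j l.+2).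
  have [il2|il2] := ltnP i (j + l); last first.
    have -> : i = j + l by lia.
    apply: (@conv_trans [:: (Cup, j + l), (Cup, (j + l).+1) & over j l]).
      by apply: (conv_catl [:: (Cup, j + l)]); apply: conv_over_slice.
    rewrite /arc /= !addnS.
    apply: (@conv_trans [:: (Cup, j + l), (Cup, j + l), X (j + l).+1, X (j + l) & over j l]).
      have h : conv [:: (Cup, (j + l).+1)] [:: (Cup, j + l); X (j + l).+1; X (j + l)].
        by apply: conv_sym (conv_cup_pass _) _ => n' m; tangle_lia.
      exact: (conv_mid [:: (Cup, j + l)] (over j l) h).
    have h := conv_exchange_sym Cup Cup (leqnn (j + l)); rewrite addn0 addn2 in h.
    exact: (conv_catr [:: X (j + l).+1, X (j + l) & over j l] h).
  apply: (@conv_trans [:: (Cup, j + l), (Cup, i) & over j l.+2]).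
    apply: (conv_catl [:: (Cup, j + l)]); apply: conv_over_cup; lia.
  have h := conv_exchange_sym Cup Cup (ltnW il2); rewrite addn0 addn2 in h.
  by rewrite /arc !addnS; apply: (conv_catr (over j l.+2) h).
apply: (reducible_conv nT h); first by rewrite harc.
have := @reducible_arc j l.+2 (T ++ [:: (Cup, i)]).
by rewrite !addnS -catA; apply; apply: IH; lia.
Qed.

Definition cap_reducible n := forall T i, normal n.+2 T -> i <= n ->
  reducible n (T ++ [:: (Cap, i)]).

Definition cross_reducible n := forall T s i, normal n T -> i.+1 < n ->
  reducible n (T ++ [:: (Cross s, i)]).

(** The bound k matters in [cross_reducible_step], where only the crossings avoiding the last strand
    are available at that stage. *)
Lemma reducible_over n k x j l :
  (forall T i, normal n T -> i < k -> reducible n (T ++ [:: X i])) ->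
  j + l <= k -> k < n -> reducible n x -> reducible n (x ++ over j l).
Proof.
move=> hX + kn; elim: l x => [|l IH] x jl rx; first by rewrite cats0.
rewrite /= -cat1s catA; apply: IH; first by lia.
apply: (reducible_cat rx); first by tangle_lia.
by move=> T nT; apply: hX => //; lia.
Qed.

Lemma reducible_under n x i l : cross_reducible n ->
  i + l < n -> reducible n x -> reducible n (x ++ under i l).
Proof.
move=> hX; elim: l i x => [|l IH] i x il rx; first by rewrite cats0.
rewrite -[under i l.+1]/([:: (Cross true, i)] ++ under i.+1 l) catA.
apply: IH; first by lia.
apply: (reducible_cat rx); first by tangle_lia.
by move=> T nT; apply: hX => //; lia.
Qed.

Lemma reducible_circle n T : normal n T -> reducible n (T ++ [:: (Cup, n); (Cap, n)]).
Proof.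
move=> nT v hv /(_ T nT) hV; rewrite -catA.
case: (posnP n) => [n0|n_gt0]; last first.
  exact: closed_circle n_gt0 (normal_tangle nT) hv hV.
case: (normalP nT) => [_ eT|j l T' e]; last by rewrite n0 in e.
rewrite {}n0 {}eT {nT T} in hv hV *.
(* With no strand present, v is empty or begins with a cup. In the second case the circle is moved
   to the right of the two legs of that cup, where [closed_circle] applies with n = 2. *)
case: v hv hV => [|[[||s] i] v] hv hV; first exact: closed_O.
- have i0 : i = 0 by move: hv; tangle_lia.
  rewrite {}i0 in hv hV *.
  have h : V [:: (Cup, 0), (Cup, 2), (Cap, 2) & v].
    by apply: (@closed_circle _ closedV [:: (Cup, 0)] v 2).
  apply: (closed_sim closedV) h.
  have h : conv [:: (Cup, 0); (Cap, 0); (Cup, 0)] [:: (Cup, 0); (Cup, 2); (Cap, 2)].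
    apply: (@conv_trans [:: (Cup, 0); (Cup, 0); (Cap, 2)]).
      exact: (conv_catl [:: (Cup, 0)] (conv_exchange_sym Cup Cap (leqnn 0))).
    exact: (conv_catr [:: (Cap, 2)] (conv_exchange_sym Cup Cup (leqnn 0))).
  by case: (conv_catr v h); apply.
- by move: hv; tangle_lia.
- by move: hv; tangle_lia.
Qed.

(** A cap away from both ends of the top arc is pulled below it, where there are two strands fewer.
    A cap meeting an end absorbs the arc, leaving a circle or crossings on n strands. *)
Lemma cap_reducible_step n : cross_reducible n ->
  (forall k, n = k.+2 -> cap_reducible k) -> cap_reducible n.
Proof.
move=> hX IH T0 i /normalP[//|j l T [en] -> nT] il; subst n.
have harc : tangle (j + l) (arc j l ++ [:: (Cap, i)]) (j + l).
  rewrite tangle_cat (tangle_width (tangle_arc j l)) tangle_arc /= /step_width /=.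
  by lia.
rewrite -catA.
have [ij|ji] := ltnP i.+1 j.
  case: j ij nT il harc hX IH => [|[|j]] // ij nT il harc hX IH.
  have ij' : i <= j by lia.
  have h := conv_arc_slide Cap l ij'; rewrite addn0 addn2 in h.
  apply: (reducible_conv nT h harc).
  have := @reducible_arc j l (T ++ [:: (Cap, i)]).
  by rewrite -catA; apply; apply: IH => //; lia.
(* The cap joins the left end of the top arc to the strand on its left. *)
have [ij|ij] := eqVneq i.+1 j.
  subst j; apply: (reducible_conv nT (conv_cup_over_cap i l) harc).
  by apply: reducible_under => //; apply: reducible_normal.
have {ji ij} ji : j <= i by lia.
(* For l = 0 the cap closes the top arc into a circle. *)
case: l il nT harc hX IH => [|l] il nT harc hX IH.
  have -> : i = j + 0 by lia.
  exact: reducible_circle.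
(* The cap joins the left end to the strand on its right, which the arc has just crossed: this last
   crossing is a kink at the cap, and without it the left end is at j + 1. *)
have [ij|ij] := eqVneq i j.
  subst i; have h : conv (arc j l.+1 ++ [:: (Cap, j)]) (under j l).
    rewrite /arc over_rcons addnS -addSn.
    apply: (@conv_trans ((Cup, j.+1 + l) :: over j.+1 l ++ [:: (Cap, j)])).
      have := conv_catl ((Cup, j.+1 + l) :: over j.+1 l) (conv_cap_kink false j).
      by rewrite /= -!catA.
    exact: conv_cup_over_cap.
  apply: (reducible_conv nT h harc).
  by apply: reducible_under => //; [lia | apply: reducible_normal].
have {ji ij} ji : j < i by lia.
(* The cap joins the right end of the top arc to the strand on its left. *)
have [il'|il'] := eqVneq i (j + l.+1).
  have h : conv (arc j l.+1 ++ [:: (Cap, i)]) (over j l).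
    by rewrite il' /arc addnS; apply: conv_cup_over_cap_last.
  apply: (reducible_conv nT h harc).
  apply: (@reducible_over _ (j + l)); [|by []|lia|exact: reducible_normal].
  by move=> T1 k nT1 kl; apply: hX => //; lia.
case: l il il' nT harc hX IH => [|l] il il' nT harc hX IH; first by lia.
have h : conv (arc j l.+2 ++ [:: (Cap, i)]) ((Cap, i.-1) :: arc j l).
  apply: (@conv_trans [:: (Cup, j + l.+2), (Cap, i.-1) & over j l]).
    by apply: (conv_catl [:: (Cup, j + l.+2)]); apply: conv_over_cap; lia.
  have il2 : i.-1 <= j + l by lia.
  have h := conv_exchange_sym Cap Cup il2; rewrite addn0 addn2 in h.
  by rewrite !addnS; apply: (conv_catr (over j l) h).
apply: (reducible_conv nT h harc); rewrite !addnS.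
have := @reducible_arc j l (T ++ [:: (Cap, i.-1)]).
rewrite -catA; apply; apply: IH; [by rewrite !addnS|by rewrite -!addnS|by lia].
Qed.

(* The two smoothings of the crossing are known to be reducible. *)
Lemma reducible_cross_sign n T s t i : cap_reducible n -> normal n.+2 T -> i <= n ->
  reducible n.+2 (T ++ [:: (Cross s, i)]) -> reducible n.+2 (T ++ [:: (Cross t, i)]).
Proof.
move=> hcap nT il hs; have [<-//|st] := eqVneq s t.
have {st} -> : t = ~~ s by case: s t st {hs} => [] [].
move=> v hv hV; rewrite -catA; apply: (closed_skein closedV).
- apply/tangle_catP; exists n.+2; first exact: normal_tangle.
  by rewrite /= /step_width /= subnK // hv andbT; lia.
- by rewrite negbK catA; apply: hs.
- exact: hV.
- suff : reducible n.+2 ((T ++ [:: (Cap, i)]) ++ [:: (Cup, i)]).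
    by move=> /(_ v hv hV); rewrite -!catA.
  apply: (reducible_cat (hcap _ _ nT il)); first by tangle_lia.
  by move=> T1 nT1; apply: reducible_cup.
Qed.

(** The crossing is moved below the top arc or merged into it, for whichever sign makes this
    possible; the smoothings needed for the other sign are covered by [cap_reducible n]. *)
Lemma cross_reducible_step n :
  cross_reducible n -> cap_reducible n -> cross_reducible n.+2.
Proof.
move=> hX hcap.
suff hsome T i : normal n.+2 T -> i <= n ->
    exists s, reducible n.+2 (T ++ [:: (Cross s, i)]).
  move=> T s i nT il; have [t] := hsome T i nT il.
  exact: reducible_cross_sign.
have harc j l a k : j + l = n -> a <= n ->
    tangle (j + l) (arc j l ++ [:: (Cross k, a)]) n.+2.
  move=> <- al.
  rewrite tangle_cat (tangle_width (tangle_arc j l)) tangle_arc /= /step_width /=.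
  by lia.
(* Such a crossing avoids the right end of the top arc. It slides below the arc, or lengthens the
   arc by one crossing, or, with sign [true], cancels its last one. *)
have hlow T1 i1 : normal n.+2 T1 -> i1 < n ->
    exists s, reducible n.+2 (T1 ++ [:: (Cross s, i1)]).
  case/normalP=> [//|j l T' [en] -> nT] il.
  have [ij|ji] := ltnP i1.+1 j.
    case: j en ij nT => [|[|j]] // en ij nT; exists false; rewrite -catA.
    have ij' : i1 <= j by lia.
    have h := conv_arc_slide (Cross false) l ij'; rewrite addn2 in h.
    apply: (reducible_conv nT h (harc _ _ _ _ _ _)) => //; first exact: ltnW.
    have := @reducible_arc j.+2 l (T' ++ [:: X i1]); rewrite -catA -en; apply.
    by apply: hX; rewrite ?en //; lia.
  have [ij|ij] := eqVneq i1.+1 j.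
    subst j; exists false; rewrite -catA.
    rewrite -[arc _ _ ++ _]/((Cup, i1.+1 + l) :: over i1.+1 l ++ [:: X i1]).
    rewrite -over_rcons addSnnS en addSnnS -/(arc i1 l.+1).
    by apply: reducible_arc; apply: reducible_normal; rewrite -addSnnS.
  have {ji ij} ji : j <= i1 by lia.
  have [ij|ij] := eqVneq i1 j.
    subst i1; case: l en nT => [|l] en nT; first by lia.
    exists true; rewrite -catA; have h : conv (arc j l.+1 ++ [:: (Cross true, j)]) (arc j.+1 l).
      rewrite /arc over_rcons addnS -addSn.
      have := conv_catl ((Cup, j.+1 + l) :: over j.+1 l) (conv_R2 false j).
      by rewrite /= cats0 -!catA.
    apply: (reducible_conv nT h (harc _ _ _ _ _ _)) => //; first by lia.
    have -> : n = j.+1 + l by lia.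
    by apply: reducible_arc; rewrite addSnnS; apply: reducible_normal.
  case: i1 il ji ij => [|i2] il ji ij; first by lia.
  have ji' : j <= i2 by lia.
  exists false; rewrite -catA; have h : conv (arc j l ++ [:: X i2.+1]) (X i2 :: arc j l).
    apply: (@conv_trans [:: (Cup, j + l), X i2 & over j l]).
      by apply: (conv_catl [:: (Cup, j + l)]); apply: conv_over_cross; lia.
    have il2 : i2 <= j + l - 2 by lia.
    have h := conv_exchange_sym (Cross false) Cup il2; rewrite subnK in h; last by lia.
    exact: (conv_catr (over j l) h).
  apply: (reducible_conv nT h (harc _ _ _ _ _ _)) => //; first exact: ltnW.
  have := @reducible_arc j l (T' ++ [:: X i2]); rewrite -catA -en; apply.
  by apply: hX; rewrite ?en //; lia.
rewrite leq_eqVlt => nT /predU1P[->{i}|]; last exact: hlow.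
(* The last crossing exchanges the right ends of the two top arcs. *)
have hlowX T1 i1 : normal n.+2 T1 -> i1 < n -> reducible n.+2 (T1 ++ [:: X i1]).
  move=> nT1 il; have [s] := hlow T1 i1 nT1 il.
  by apply: reducible_cross_sign => //; apply: ltnW.
case/normalP: nT => [//|j l T' [en] -> nT]; exists false; rewrite -catA.
case: l en nT => [|l] en nT.
  (* Both strands of the crossing are legs of the top arc: a kink at a minimum. *)
  rewrite addn0 in en; subst j.
  have h : conv (arc n 0 ++ [:: X n]) (arc n 0).
    by rewrite /arc /= addn0; apply: conv_cup_kink.
  apply: (reducible_conv nT h (harc _ _ _ _ _ _)) => //; first by rewrite addn0.
  by have := @reducible_arc n 0 T'; rewrite addn0 in nT *; apply; apply: reducible_normal.
case/normalP: (nT) => [|k m T'' en2 eT nT2]; first by lia.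
have en' : n = (k + m).+2 by rewrite en.
(* If the left end of the top arc is to the right of that of the next one, the crossing is removed
   by exchanging the two arcs, which gives a normal word. *)
have top a b : k <= a -> a + b = k + m ->
    reducible n.+2 (T'' ++ arc k m ++ arc a.+1 b.+1 ++ [:: X n]).
  move=> ka ab.
  have h1 := conv_arcs_cross ka (erefl (k + m)) ab.
  have h2 := conv_arcs_nested ka (erefl (k + m)) ab.
  have [/(_ (k + m) n.+2) s1] := h1; have [/(_ (k + m) n.+2) s2] := h2.
  have t1 : tangle (k + m) (arc k m ++ arc a.+1 b.+1 ++ [:: X (k + m).+2]) n.+2.
    apply/tangle_catP; exists (k + m).+2; first exact: tangle_arc.
    apply/tangle_catP; exists n.+2; last by tangle_lia.
    by have := tangle_arc a.+1 b.+1; rewrite addSn addnS ab -en'.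
  have t2 : tangle (k + m) (arc a b ++ arc k m.+2) n.+2.
    apply/tangle_catP; exists (k + m).+2; first by rewrite -ab; apply: tangle_arc.
    by have := tangle_arc k m.+2; rewrite !addnS en'.
  have s12 := rst_trans _ _ _ _ _ (s1 t1) (rst_sym _ _ _ _ (s2 t2)).
  have := sim_cat (normal_tangle nT2) (_ : tangle n.+2 [::] n.+2) s12.
  rewrite !cats0 en' => /(_ (eqxx _)) s.
  apply: reducible_sim s _.
  have := @reducible_arc k m.+2 (T'' ++ arc a b); rewrite !addnS -catA; apply.
  by apply: reducible_normal; rewrite -ab; constructor; rewrite ab.
(* If the left end of the top arc is to the left of that of the next one, the
   part of the top arc on the left of k is moved past the crossing. *)
rewrite eT -catA; have [kj|jk] := ltnP k j.
  by case: j en kj {nT en2} => [|j] en kj //; apply: top; lia.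
have el : l.+1 = (m.+1 + (k.+1 - j)) by lia.
have -> : arc j l.+1 = arc k.+1 m.+1 ++ over j (k.+1 - j).
  by rewrite /arc el over_cat subnKC ?(leq_trans jk) //= ; congr ((Cup, _) :: _); lia.
have h : conv (over j (k.+1 - j) ++ [:: X n]) (X n :: over j (k.+1 - j)).
  by apply: conv_over_slice => /=; lia.
have h' := conv_catl (arc k m ++ arc k.+1 m.+1) h.
rewrite -!catA in h' *.
apply: (reducible_conv nT2 h').
  apply/tangle_catP; exists (k + m).+2; first exact: tangle_arc.
  apply/tangle_catP; exists n.+2.
    by have := tangle_arc k.+1 m.+1; rewrite addSn addnS -en'.
  by apply/tangle_catP; exists n.+2; rewrite ?tangle_over /= /step_width /=; lia.
have -> : T'' ++ arc k m ++ arc k.+1 m.+1 ++ X n :: over j (k.+1 - j)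
   = (T'' ++ arc k m ++ arc k.+1 m.+1 ++ [:: X n]) ++ over j (k.+1 - j).
  by rewrite -!catA.
by apply: (reducible_over hlowX); [lia | | exact: top].
Qed.

(** Both reducibility steps go from n to n + 2, so the induction carries two consecutive values of
    n. The word is then read slice by slice. *)
Theorem skein_closed_all w : tangle 0 w 0 -> V w.
Proof.
have hall n : (cross_reducible n /\ cap_reducible n) /\
    (cross_reducible n.+1 /\ cap_reducible n.+1).
  elim: n => [|n [IH0 IH1]].
    have c0 : cross_reducible 0 by [].
    have c1 : cross_reducible 1 by [].
    by split; split=> //; apply: cap_reducible_step.
  have c2 := cross_reducible_step IH0.1 IH0.2.
  split=> //; split=> //; apply: cap_reducible_step => // k [<-].
  exact: IH0.2.
(* The claim is extended to open words; for a closed one the only normal word left is the empty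
   one. *)
suff hred n : tangle 0 w n -> reducible n w.
  move=> hw; have := hred 0 hw [::]; rewrite cats0; apply=> // T.
  by case/normalP=> // _ ->; rewrite cats0; apply: closed_nil.
elim/last_ind: w n => [|w [e i] IH] n.
  by rewrite /= => /eqP <-; apply: reducible_normal; constructor.
rewrite -cats1 => /tangle_catP[k hw he].
apply: (reducible_cat (IH _ hw) he) => T nT.
case: e he => [||s] /= /andP[]; rewrite /step_width /= => il.
- by move/eqP=> <-; rewrite subn0 addn2; apply: reducible_cup => //; lia.
- move/eqP=> en; have ek : k = n.+2 by lia.
  by rewrite ek in nT il *; apply: (hall n).1.2 => //; lia.
- move/eqP=> en; have ek : k = n by lia.
  by rewrite ek in nT il *; apply: (hall n).1.1 => //; lia.
Qed.

End Reduction.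

(** * Counting two-colourings *)

Definition transitions (a : piece) (p : bitseq) : seq bitseq :=
  match a, p with
  | Cup, [::] => [:: [:: false; false]; [:: true; true]]
  | Cap, [:: x; y] => if x == y then [:: [::]] else [::]
  | Cross _, [:: x; y] => [:: [:: y; x]]
  | _, _ => [::]
  end.

Definition succ (a : slice) (s : bitseq) : seq bitseq :=
  [seq take a.2 s ++ q ++ drop (a.2 + ins a.1) s
     | q <- transitions a.1 (take (ins a.1) (drop a.2 s))].

(* Weighted number of ways to extend the colouring s of the bottom strands to
   a two-colouring of the components of w, the colouring of the top strands
   having weight phi: this is linear in phi and multiplicative in w. *)
Fixpoint colorings (w : word) (phi : bitseq -> nat) (s : bitseq) : nat :=
  if w is a :: w' then \sum_(s' <- succ a s) colorings w' phi s' else phi s.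

Definition closed_weight (s : bitseq) : nat := nilp s.

Lemma colorings_cat u v phi s :
  colorings (u ++ v) phi s = colorings u (colorings v phi) s.
Proof. by elim: u s => //= a u IH s; apply: eq_bigr => s' _. Qed.

Lemma succE a i r p t : size r = i -> size p = ins a ->
  succ (a, i) (r ++ p ++ t) = [seq r ++ q ++ t | q <- transitions a p].
Proof.
move=> ri pa; rewrite /succ /= (take_size_cat _ ri) (drop_size_cat _ ri) (take_size_cat _ pa).
by rewrite catA drop_size_cat // size_cat ri pa.
Qed.

Lemma split_at (s : bitseq) i k : i + k <= size s ->
  exists r p t, [/\ s = r ++ p ++ t, size r = i & size p = k].
Proof.
move=> ik; exists (take i s), (take k (drop i s)), (drop k (drop i s)).
by rewrite !cat_take_drop !size_takel ?size_drop //; lia.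
Qed.

Lemma size_transitions a p q : q \in transitions a p -> size q = outs a.
Proof.
case: a p => [||s] [|x [|y [|? ?]]] //=; rewrite ?inE.
- by case/orP=> /eqP->.
- by case: eqP => // _; rewrite inE => /eqP->.
- by move/eqP->.
Qed.

Lemma size_succ a s s' : a.2 + ins a.1 <= size s -> s' \in succ a s ->
  size s' = step_width (size s) a.
Proof.
case: a => e i /= /split_at[r [p [t [-> ri pe]]]]; rewrite succE //.
case/mapP=> q /size_transitions qe ->.
by rewrite /step_width !size_cat qe /= ri pe; lia.
Qed.

Lemma eq_colorings n w m phi psi s : tangle n w m -> size s = n ->
  (forall s', size s' = m -> phi s' = psi s') ->
  colorings w phi s = colorings w psi s.
Proof.
move=> + + eq_phi; elim: w n s => [|a w IH] n s /=.
  by move=> /eqP nm sn; apply: eq_phi; rewrite sn.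
case/andP=> an hw sn; rewrite -sn in an hw.
apply: eq_big_seq => s' s's.
by apply: IH hw _; apply: size_succ.
Qed.

Lemma leq_colorings n w m phi psi s : tangle n w m -> size s = n ->
  (forall s', size s' = m -> phi s' <= psi s') ->
  colorings w phi s <= colorings w psi s.
Proof.
move=> + + le_phi; elim: w n s => [|a w IH] n s /=.
  by move=> /eqP nm sn; apply: le_phi; rewrite sn.
case/andP=> an hw sn; rewrite -sn in an hw.
rewrite big_seq [leqRHS]big_seq; apply: leq_sum => s' s's.
by apply: IH hw _; apply: size_succ.
Qed.

Lemma colorings_add w phi psi s :
  colorings w (fun s' => phi s' + psi s') s = colorings w phi s + colorings w psi s.
Proof.
elim: w s => //= a w IH s; rewrite -big_split.
by apply: eq_bigr => s' _; apply: IH.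
Qed.

Lemma colorings_shift i w phi (r s : bitseq) : size r = i ->
  colorings (shift i w) phi (r ++ s) = colorings w (fun s' => phi (r ++ s')) s.
Proof.
move=> ri; elim: w s => //= [[a k] w] IH s.
have -> : succ (a, k + i) (r ++ s) = [seq r ++ s' | s' <- succ (a, k) s].
  rewrite /succ /= !drop_cat !take_cat ri.
  have -> : (k + i < i) = false by lia.
  have -> : (k + i + ins a < i) = false by lia.
  have -> : k + i - i = k by lia.
  have -> : k + i + ins a - i = k + ins a by lia.
  by rewrite -map_comp; apply: eq_map => q /=; rewrite -catA.
by rewrite big_map; apply: eq_bigr => s' _; apply: IH.
Qed.

Lemma colorings_exchange a b i j n m phi s : i <= j ->
  tangle n [:: (a, i); (b, j + outs a)] m -> size s = n ->
  colorings [:: (a, i); (b, j + outs a)] phi s =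
  colorings [:: (b, j + ins a); (a, i)] phi s.
Proof.
move=> ij /= /andP[/= ia /andP[/= jb _]] sn; subst n.
have {}jb : j + ins a + ins b <= size s by move: jb; rewrite /step_width /=; lia.
have [r0 [p' [t [-> rj pb]]]] := split_at jb.
have /split_at[r [p [u [er ri pa]]]] : i + ins a <= size r0 by rewrite rj; lia.
have uj : size r + size u = j by move: rj; rewrite er !size_cat pa; lia.
rewrite /= (succE _ rj pb) [RHS]big_map er -!catA (succE _ ri pa) [LHS]big_map.
transitivity (\sum_(q <- transitions a p) \sum_(q' <- transitions b p')
    phi (r ++ q ++ u ++ q' ++ t)).
  apply: eq_big_seq => q /size_transitions qa.
  have -> : r ++ q ++ u ++ p' ++ t = (r ++ q ++ u) ++ p' ++ t by rewrite -!catA.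
  rewrite succE ?big_map //; last by rewrite !size_cat qa; lia.
  by apply: eq_bigr => q' _; rewrite -!catA.
rewrite exchange_big; apply: eq_bigr => q' _.
have -> : (r ++ p ++ u) ++ q' ++ t = r ++ p ++ (u ++ q' ++ t) by rewrite -!catA.
by rewrite (succE _ ri pa) big_map.
Qed.

Lemma succ_0 u x y c :
  [/\ succ (Cup, 0) u = [:: [:: false, false & u]; [:: true, true & u]],
      succ (Cap, 0) [:: x, y & u] = if x == y then [:: u] else [::]
    & succ (Cross c, 0) [:: x, y & u] = [:: [:: y, x & u]]].
Proof.
by split; rewrite /succ /= ?add1n ?add0n /= ?drop0 ?take0 //; case: (x == y).
Qed.

Lemma succ_1 u x y z c :
  [/\ succ (Cup, 1) (z :: u) = [:: [:: z, false, false & u]; [:: z, true, true & u]],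
      succ (Cap, 1) [:: z, x, y & u] = if x == y then [:: z :: u] else [::]
    & succ (Cross c, 1) [:: z, x, y & u] = [:: [:: z, y, x & u]]].
Proof.
by split; rewrite /succ /= ?add1n ?add0n /= ?drop0 ?take0 //; case: (x == y).
Qed.

Lemma colorings_elementary t t' n m phi s : elementary t t' ->
  tangle n t m -> size s = n -> colorings t phi s = colorings t' phi s.
Proof.
move=> + + sn; subst n.
(* Only the k strands from position i on are involved: after shifting i to 0 a finite check on their
   colours remains, with arbitrary colours u further right. *)
have local i w w' k : tangle (size s) (shift i w) m -> i + k <= size s ->
    (forall p u phi', size p = k ->
      colorings w phi' (p ++ u) = colorings w' phi' (p ++ u)) ->
    colorings (shift i w) phi s = colorings (shift i w') phi s.
  move=> _ /split_at[r [p [u [-> ri pk]]]] h.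
  by rewrite !colorings_shift // h.
have cup0 u := let: And3 h _ _ := succ_0 u true true true in h.
have cap0 u x y := let: And3 _ h _ := succ_0 u x y true in h.
have cross0 u x y c := let: And3 _ _ h := succ_0 u x y c in h.
have cup1 u z := let: And3 h _ _ := succ_1 u true true z true in h.
have cap1 u x y z := let: And3 _ h _ := succ_1 u x y z true in h.
have cross1 u x y z c := let: And3 _ _ h := succ_1 u x y z c in h.
have succ01 := (cup0, cap0, cross0, cup1, cap1, cross1, big_cons, big_nil).
case=> {t t'} [t t' []|t t' []|t t' []|right e i].
- move=> a b i j ij ht; exact: colorings_exchange ij ht _.
- move=> i ht; apply: (local i [:: (Cup, 0); (Cap, 1)] [::] 1) => //.
    by move: ht; tangle_lia.
  by move=> [|x []] // u phi' _; rewrite /= !succ01; case: x; rewrite /= ?succ01 /=; lia.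
- move=> i ht; apply: (local i [:: (Cup, 1); (Cap, 0)] [::] 1) => //.
    by move: ht; tangle_lia.
  by move=> [|x []] // u phi' _; rewrite /= !succ01; case: x; rewrite /= ?succ01 /=; lia.
- move=> c i ht; apply: (local i [:: (Cross c, 0); (Cap, 1)]
    [:: (Cross (~~ c), 1); (Cap, 0)] 3) => //.
    by move: ht; tangle_lia.
  by move=> [|x [|y [|z []]]] // u phi' _; case: x y z => [] [] [];
    rewrite /= !succ01 /= ?succ01 ?addn0.
- move=> c i ht; apply: (local i [:: (Cup, 1); (Cross c, 0)]
    [:: (Cup, 0); (Cross (~~ c), 1)] 1) => //.
    by move: ht; tangle_lia.
  by move=> [|x []] // u phi' _; rewrite /= !succ01; case: x; rewrite /= ?succ01 /=; lia.
- move=> c i ht; apply: (local i [:: (Cross c, 0); (Cross (~~ c), 0)] [::] 2) => //.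
    by move: ht; tangle_lia.
  by move=> [|x [|y []]] // u phi' _; rewrite /= !succ01 !addn0.
- move=> b c d i _ ht; apply: (local i [:: (Cross b, 0); (Cross c, 1); (Cross d, 0)]
    [:: (Cross d, 1); (Cross c, 0); (Cross b, 1)] 3) => //.
    by move: ht; tangle_lia.
  by move=> [|x [|y [|z []]]] // u phi' _; case: x y z => [] [] [];
    rewrite /= !succ01 /= ?succ01 ?addn0.
- case: right => ht.
    apply: (local i [:: (Cup, 1); (Cross e, 0); (Cap, 1)] [::] 1) => //.
      by move: ht; tangle_lia.
    by move=> [|x []] // u phi' _; rewrite /= !succ01; case: x; rewrite /= ?succ01 /=; lia.
  apply: (local i [:: (Cup, 0); (Cross e, 1); (Cap, 0)] [::] 1) => //.
    by move: ht; tangle_lia.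
  by move=> [|x []] // u phi' _; rewrite /= !succ01; case: x; rewrite /= ?succ01 /=; lia.
Qed.

Definition coloring_count (w : word) : nat := colorings w closed_weight [::].

Lemma coloring_count_sim w w' : sim 0 0 w w' -> coloring_count w = coloring_count w'.
Proof.
elim=> // [x y [hx hy [u [t [t' [v [tt' ex ey]]]]]]|x y z _ -> _ -> //].
rewrite /coloring_count ex ey !colorings_cat; move: hx; rewrite ex.
case/tangle_catP=> n hu /tangle_catP[m ht _].
apply: eq_colorings hu _ _ => // s sn; rewrite !colorings_cat.
exact: colorings_elementary tt' ht sn.
Qed.

Lemma colorings_circle n w phi s : size s = n ->
  colorings [:: (Cup, n), (Cap, n) & w] phi s = 2 * colorings w phi s.
Proof.
move=> sn; have cupE := @succE Cup n s [::] [::] sn erefl.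
rewrite !cats0 in cupE; rewrite /= cupE /= !big_cons big_nil.
have capE b : succ (Cap, n) (s ++ [:: b; b]) = [:: s].
  by have := @succE Cap n s [:: b; b] [::] sn erefl; rewrite /= eqxx /= cats0.
by rewrite !capE !big_seq1; lia.
Qed.

(** * Linear structure of colourings over F_2 *)

Definition xorb_seq (s s' : bitseq) : bitseq := [seq x.1 (+) x.2 | x <- zip s s'].

Lemma xorb_seq_cat s1 s2 t1 t2 : size s1 = size t1 ->
  xorb_seq (s1 ++ s2) (t1 ++ t2) = xorb_seq s1 t1 ++ xorb_seq s2 t2.
Proof. by move=> h; rewrite /xorb_seq zip_cat // map_cat. Qed.

Lemma nth_xorb_seq s t i : size s = size t ->
  nth false (xorb_seq s t) i = nth false s i (+) nth false t i.
Proof. by elim: s t i => [|x s IH] [|y t] [|i] //= [] /IH. Qed.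

Lemma size_xorb_seq n s t : size s = n -> size t = n -> size (xorb_seq s t) = n.
Proof. by move=> sn tn; rewrite size_map size_zip sn tn minnn. Qed.

(* The support of phi is an affine subspace over F_2 on which phi is constant,
   and it is a linear subspace unless phi vanishes at the origin. *)
Definition affine (n : nat) (phi : bool -> bitseq -> nat) : Prop :=
  forall c c' s s', size s = n -> size s' = n -> 0 < phi c s ->
    phi (c (+) c') (xorb_seq s s') = phi c' s'.

(** The admissible pairs of bottom and top colours form a linear subspace, so translation by an
    admissible pair is a bijection between fibres. *)
Lemma transitions_xorb a p p' q : size p = ins a -> size p' = ins a ->
  q \in transitions a p ->
  perm_eq (transitions a (xorb_seq p p')) [seq xorb_seq q q' | q' <- transitions a p'].
Proof.
case: a => [||c].
- by case: p p' => [|??] [|??] //= _ _; rewrite !inE => /orP[] /eqP->.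
- case: p p' => [|x [|y [|??]]] [|x' [|y' [|??]]] //= _ _.
  by case: x x' y y' => [] [] [] [] //=; rewrite inE => /eqP->.
- case: p p' => [|x [|y [|??]]] [|x' [|y' [|??]]] //= _ _.
  by rewrite inE => /eqP->.
Qed.

Lemma colorings_affine n w m phi : tangle n w m -> affine m phi ->
  affine n (fun c => colorings w (phi c)).
Proof.
move=> + phi_affine; elim: w n => [|[a i] w IH] n /=; first by move/eqP->.
case/andP=> ian /IH{}IH c c' s s' sn s'n.
have ian' := ian; rewrite -{1}sn in ian; rewrite -{1}s'n in ian'.
have [r [p [t [es ri pa]]]] := split_at ian.
have [r' [p' [t' [es' ri' pa']]]] := split_at ian'.
have tt' : size t = size t'.
  by move: sn s'n; rewrite es es' !size_cat; lia.
rewrite es es' [in X in 0 < X]succE // big_map => s_gt0.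
(* Positive weight provides one continuation q of s; translation by q matches the continuations of
   s' with those of the sum. *)
have [q qp q_gt0] : exists2 q, q \in transitions a p &
    0 < colorings w (phi c) (r ++ q ++ t).
  apply/hasP; apply: contraLR s_gt0 => /hasPn h; rewrite -eqn0Ngt big_seq big1 // => q qp.
  by have := h q qp; rewrite -eqn0Ngt => /eqP.
rewrite xorb_seq_cat ?ri // xorb_seq_cat ?pa //.
rewrite !succE ?big_map //; try exact: size_xorb_seq.
rewrite (perm_big _ (transitions_xorb pa pa' qp)) /= big_map.
apply: eq_big_seq => q' q'p'.
have qq' : size q = size q' by rewrite (size_transitions qp) (size_transitions q'p').
rewrite -xorb_seq_cat // -xorb_seq_cat ?ri //; apply: IH => //.
- rewrite /step_width -sn es !size_cat (size_transitions qp) /= ri pa; lia.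
- rewrite /step_width -s'n es' !size_cat (size_transitions q'p') /= ri' pa'; lia.
Qed.

(** [phi true] describes a coset of the subspace described by [phi false]: it contributes nothing,
    or exactly as much. *)
Lemma affine_half u n phi : tangle 0 u n -> affine n phi ->
  colorings u (phi true) [::] <= colorings u (phi false) [::].
Proof.
move=> hu /(colorings_affine hu) h.
case: (posnP (colorings u (phi true) [::])) => [-> //|gt0].
by have := h true true [::] [::] erefl erefl gt0 => /= ->.
Qed.

Lemma closed_weight_affine : affine 0 (fun _ => closed_weight).
Proof. by move=> c c' [|//] [|//]. Qed.

Section Smoothing.
Variables (u v : word) (i : nat) (s : bool).
Hypothesis uXv : tangle 0 (u ++ [:: (Cross s, i)] ++ v) 0.

Let cut : exists n, [/\ tangle 0 u n, i + 2 <= n & tangle n v 0].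
Proof.
case/tangle_catP: uXv => n hu /= /andP[/= il].
by rewrite /step_width /= subnK; [exists n | lia].
Qed.

Let weight := colorings v closed_weight.

(** The colourings of a smoothing, weighted by [psi], split into a subspace of colourings that also
    colour the crossing, and at most one further coset. *)
Let smoothing_bound n phi psi : tangle 0 u n -> affine n phi ->
  (forall p, size p = n -> psi p = phi false p + phi true p) ->
  (forall r x y t, size (r ++ [:: x; y] ++ t) = n -> size r = i ->
    phi false (r ++ [:: x; y] ++ t) <= weight (r ++ [:: y; x] ++ t)) ->
  i + 2 <= n -> 
  colorings u psi [::] <= 2 * coloring_count (u ++ [:: (Cross s, i)] ++ v).
Proof.
move=> hu phi_affine psiE phi_le il.
rewrite (eq_colorings hu _ psiE) // colorings_add mul2n -addnn.
have h : colorings u (phi false) [::] <= coloring_count (u ++ [:: (Cross s, i)] ++ v).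
  rewrite /coloring_count colorings_cat; apply: leq_colorings hu _ _ => // p pn.
  rewrite -pn in il; have [r [[|x [|y [|??]]] [t [ep ri]]]] // := split_at il.
  move=> _; rewrite colorings_cat /= ep succE // big_seq1.
  by apply: phi_le; rewrite -?ep.
by apply: leq_add => //; apply: leq_trans h; apply: affine_half hu phi_affine.
Qed.

Let odd_at (p : bitseq) := nth false p i (+) nth false p i.+1.

Let odd_at_cat r x y t : size r = i -> odd_at (r ++ [:: x; y] ++ t) = x (+) y.
Proof.
by move=> ri; rewrite /odd_at !nth_cat ri ltnn subnn (ltnNge i.+1) leqnSn subSnn.
Qed.

Let odd_at_xorb p p' : size p = size p' ->
  odd_at (xorb_seq p p') = odd_at p (+) odd_at p'.
Proof.
move=> pp'; rewrite /odd_at !nth_xorb_seq //.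
by do 2 case: (nth false p _); do 2 case: (nth false p' _).
Qed.

Lemma coloring_count_vertical :
  coloring_count (u ++ v) <= 2 * coloring_count (u ++ [:: (Cross s, i)] ++ v).
Proof.
have [n [hu il hv]] := cut.
have w_affine := colorings_affine hv closed_weight_affine.
rewrite {1}/coloring_count colorings_cat.
(* The colourings are split according to whether the two vertical strands have equal colours; if
   they do, exchanging the strands changes nothing. *)
apply: (smoothing_bound (phi := fun c p => (odd_at p == c) * weight p)) (hu) _ _ _ il.
- move=> c c' p p' pn p'n; case: eqP => // <- w_gt0; rewrite mul1n in w_gt0.
  have /= w_eq := w_affine false false p p' pn p'n w_gt0.
  rewrite /weight w_eq odd_at_xorb ?pn //; congr (_ * _).
  by case: (odd_at p) (odd_at p') c' => [] [] [].
- by move=> p _; case: (odd_at p); rewrite /= ?mul1n ?mul0n ?addn0.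
- by move=> r x y t _ ri; rewrite odd_at_cat //; case: x y => [] []; rewrite ?mul1n.
Qed.

Lemma coloring_count_horizontal :
  coloring_count (u ++ [:: (Cap, i); (Cup, i)] ++ v) <=
  2 * coloring_count (u ++ [:: (Cross s, i)] ++ v).
Proof.
have [n [hu il hv]] := cut.
have w_affine := colorings_affine hv closed_weight_affine.
rewrite {1}/coloring_count colorings_cat.
(* Below the cap the two strands agree, and above the cup they agree again; c is the difference
   between the two colours. *)
pose flip (c : bool) (p : bitseq) :=
  take i p ++ [:: nth false p i (+) c; nth false p i.+1 (+) c] ++ drop (i + 2) p.
have flipE c r x y t : size r = i ->
    flip c (r ++ [:: x; y] ++ t) = r ++ [:: x (+) c; y (+) c] ++ t.
  move=> ri; rewrite /flip take_size_cat // !nth_cat ri ltnn subnn.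
  rewrite (ltnNge i.+1) leqnSn subSnn; congr (_ ++ _ ++ _).
  by rewrite catA drop_size_cat // size_cat ri.
have splitE (p : bitseq) : size p = n ->
    exists r x y t, p = r ++ [:: x; y] ++ t /\ size r = i.
  move=> pn; have ip : i + 2 <= size p by rewrite pn.
  have [r [[|x [|y [|??]]] [t [ep ri]]]] // := split_at ip.
  by exists r, x, y, t.
apply: (smoothing_bound (phi := fun c p => ~~ odd_at p * weight (flip c p))) (hu) _ _ _ il.
- move=> c c' p p' pn p'n.
  have [r [x [y [t [ep ri]]]]] := splitE p pn.
  have [r' [x' [y' [t' [ep' ri']]]]] := splitE p' p'n.
  have rr' : size r = size r' by rewrite ri ri'.
  have tt' : size t = size t' by move: pn p'n; rewrite ep ep' !size_cat rr' /=; lia.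
  rewrite ep ep' !xorb_seq_cat //= !odd_at_cat ?flipE ?(size_xorb_seq ri) //.
  case: (boolP (x (+) y)) => [//|xy]; rewrite mul1n => w_gt0.
  pose q' := r' ++ [:: x' (+) c'; y' (+) c'] ++ t'.
  have -> : weight q' = weight (xorb_seq (r ++ [:: x (+) c; y (+) c] ++ t) q').
    apply/esym; apply: (w_affine false false) => //.
      by rewrite -pn ep !size_cat.
    by rewrite -p'n ep' !size_cat.
  rewrite !xorb_seq_cat //=; congr (_ * weight (_ ++ _)); last first.
    by case: x x' y y' c c' {ep ep' xy w_gt0 q'} => [] [] [] [] [] [].
  by case: x x' y y' {ep ep' w_gt0 q'} xy => [] [] [] [].
- move=> p /splitE[r [x [y [t [-> ri]]]]]; rewrite odd_at_cat // !flipE //.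
  have /= capE := @succE Cap i r [:: x; y] t ri erefl.
  have /= cupE := @succE Cup i r [::] t ri erefl.
  rewrite /= capE; case: x y {capE} => [] []; rewrite /= ?big_nil // big_seq1;
    by rewrite cupE !big_cons big_nil /weight /=; lia.
- move=> r x y t _ ri; rewrite odd_at_cat // flipE // !addbF.
  by case: x y => [] []; rewrite ?mul1n.
Qed.

End Smoothing.

(** * Colourings and components *)

(** A set respecting e is a union of components, and is determined by the roots it contains, which
    can be chosen freely. *)
Lemma card_component_sets (T : finType) (e : rel T) : symmetric e ->
  #|[set A : {set T} | [forall x, forall y, e x y ==> ((x \in A) == (y \in A))]]|
  = 2 ^ n_comp e predT.
Proof.
move=> e_sym; have c_sym : connect_sym e by apply: sym_connect_sym.
pose saturate (B : {set T}) := [set x | fingraph.root e x \in B].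
pose reps := [set x | fingraph.roots e x].
have -> : [set A : {set T} | [forall x, forall y, e x y ==> ((x \in A) == (y \in A))]]
    = saturate @: powerset reps.
  apply/setP=> A; rewrite inE; apply/idP/imsetP => [hA|[B _ ->]].
    have A_root x : (fingraph.root e x \in A) = (x \in A).
      have clA : closed e A.
        by move=> y z yz; move/forallP/(_ y)/forallP/(_ z)/implyP/(_ yz)/eqP: hA.
      by rewrite (closed_connect clA (connect_root e x)).
    exists (A :&: reps).
      by rewrite powersetE subsetIr.
    by apply/setP=> x; rewrite !inE A_root roots_root // andbT.
  apply/forallP=> x; apply/forallP=> y; apply/implyP=> xy; rewrite !inE.
  by rewrite (fingraph.rootP c_sym (connect1 xy)).
rewrite card_in_imset.
  rewrite card_powerset /n_comp_mem; congr (2 ^ _).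
  by apply: eq_card => x; rewrite !inE andbT.
move=> B C; rewrite !powersetE => /subsetP hB /subsetP hC /setP BC.
apply/setP=> x; have [xr|xr] := boolP (fingraph.roots e x).
  by have := BC x; rewrite !inE (eqP xr).
by rewrite (contraNF (hB x) _) ?inE // (contraNF (hC x) _) ?inE.
Qed.

(** The colourings themselves rather than their number: lists of the colours at the successive
    levels, omitting the initial level s. *)
Fixpoint runs (w : word) (s : bitseq) : seq (seq bitseq) :=
  if w is a :: w' then [seq s' :: p | s' <- succ a s, p <- runs w' s']
  else if nilp s then [:: [::]] else [::].

Lemma size_runs w s : size (runs w s) = colorings w closed_weight s.
Proof.
elim: w s => [|a w IH] s /=; first by rewrite /closed_weight; case: nilp.
rewrite size_allpairs_dep sumnE big_map; apply: eq_bigr => s' _; exact: IH.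
Qed.

Lemma uniq_succ a s : uniq (succ a s).
Proof.
rewrite map_inj_uniq; last first.
  move=> q q' /eqP; rewrite eqseq_cat // eqxx /= => /eqP h.
  have := congr1 size h; rewrite !size_cat => hs; apply/eqP.
  by move/eqP: h; rewrite eqseq_cat ?eqxx ?andbT //; lia.
case: a => [[||c] i] /=; case: (take _ _) => [|x [|y []]] //=.
by case: eqP.
Qed.

Lemma uniq_runs w s : uniq (runs w s).
Proof.
elim: w s => [|a w IH] s /=; first by case: nilp.
apply: allpairs_uniq_dep => [|s' _|]; [exact: uniq_succ|exact: IH|].
by move=> [x p] [y q] _ _ /= [-> ->].
Qed.

Lemma mem_runs w s p : (p \in runs w s) =
  [&& size p == size w,
      all (fun k => nth [::] p k \in succ (nth (Cup, 0) w k) (nth [::] (s :: p) k))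
        (iota 0 (size w))
    & nilp (last s p)].
Proof.
elim: w s p => [|a w IH] s p /=.
  by case: p => [|x p] /=; case: nilp.
case: p => [|s' p] /=.
  by apply/negbTE/negP => /allpairsPdep[? [? []]].
have -> : (s' :: p \in [seq x :: q | x <- succ a s, q <- runs w x]) =
    (s' \in succ a s) && (p \in runs w s').
  apply/allpairsPdep/andP => [[x [q [xs qr [-> ->]]]] //|[s's pr]].
  by exists s', p.
rewrite IH eqSS (iotaDl 1 0) all_map; case: (s' \in _); rewrite ?andbF //=.
Qed.

(** Compares the adjacency of points, which defines components, with the transfer matrix of one
    slice: outer strands keep their colours, and adjacency within the piece amounts to its
    transitions. *)
Lemma passes_transitions e i (r p t : bitseq) r' q t' :
  size r = i -> size p = ins e -> size r' = i -> size q = outs e ->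
  size t = size t' ->
  reflect [/\ forall x y, x < size (r ++ p ++ t) -> y < size (r' ++ q ++ t') ->
              passes (e, i) x y ->
              nth false (r ++ p ++ t) x = nth false (r' ++ q ++ t') y,
            if e is Cap then nth false (r ++ p ++ t) i = nth false (r ++ p ++ t) i.+1
            else True
          & if e is Cup then nth false (r' ++ q ++ t') i = nth false (r' ++ q ++ t') i.+1
            else True]
    ([&& r == r', t == t' & q \in transitions e p]).
Proof.
move=> ri pe ri' qe tt'.
have nthr (a b : bitseq) x : x < size a -> nth false (a ++ b) x = nth false a x.
  by move=> h; rewrite nth_cat h.
have nthp (a b c : bitseq) k : size a = i -> k < size b ->
    nth false (a ++ b ++ c) (i + k) = nth false b k.
  by move=> ai h; rewrite nth_cat ltnNge ai leq_addr /= addKn nth_cat h.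
have ntht (a b c : bitseq) k m : size a = i -> size b = m ->
    nth false (a ++ b ++ c) (i + m + k) = nth false c k.
  by move=> ai bm; rewrite catA nth_cat size_cat ai bm ltnNge leq_addr /= addKn.
have p0 b (a c : bitseq) : size a = i -> 0 < size b ->
    nth false (a ++ b ++ c) i = nth false b 0.
  by move=> ai b0; have := nthp a b c 0 ai b0; rewrite addn0.
have p1 b (a c : bitseq) : size a = i -> 1 < size b ->
    nth false (a ++ b ++ c) i.+1 = nth false b 1.
  by move=> ai b0; have := nthp a b c 1 ai b0; rewrite addn1.
apply: (iffP and3P) => [[/eqP <- /eqP <- hq]|[hpass hcap hcup]].
- split.
  + move=> x y _ _ /= /or3P[/andP[xi /eqP->]|/andP[xi /eqP->]|].
    * by rewrite !nthr ?ri.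
    * have -> : x = i + ins e + (x - (i + ins e)) by lia.
      rewrite ntht //.
      have -> : i + ins e + (x - (i + ins e)) - ins e + outs e =
          i + outs e + (x - (i + ins e)) by lia.
      by rewrite ntht.
    * case: e pe qe hq => // c /= pe qe.
      case: p pe => [|a [|b []]] //= _; rewrite inE => /eqP hq.
      move=> /orP[] /andP[/eqP-> /eqP->].
        by rewrite (p0 [:: a; b]) // p1 ?hq.
      by rewrite (p1 [:: a; b]) // p0 ?hq.
  + case: e pe qe hq => //= pe qe hq; rewrite !p0 ?pe // p1 ?pe //.
    by case: p pe hq => [|a [|b []]] //= _; case: eqP.
  + case: e pe qe hq => //= pe qe hq; rewrite !p0 ?qe // p1 ?qe //.
    by case: p pe hq => //= _; rewrite !inE => /orP[] /eqP->.
- split.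
  + apply/eqP/(@eq_from_nth _ false); rewrite ?ri ?ri' // => k ki.
    have := hpass k k; rewrite !nthr ?ri ?ri' //; apply.
    * by rewrite size_cat ri ltn_addr.
    * by rewrite size_cat ri' ltn_addr.
    * by rewrite /= ki eqxx.
  + apply/eqP/(@eq_from_nth _ false) => // k kt.
    have := hpass (i + ins e + k) (i + outs e + k); rewrite !ntht //; apply.
    * by rewrite !size_cat ri pe -addnA ltn_add2l ltn_add2l.
    * by rewrite !size_cat ri' qe -addnA -tt' ltn_add2l ltn_add2l.
    * by apply/or3P; apply: Or32; lia.
  + case: e pe qe hpass hcap hcup => [||c] /= pe qe hpass hcap hcup.
    * case: p pe {hpass} => //= _.
      rewrite p0 ?p1 ?qe // in hcup.
      by case: q qe hcup => [|a [|b []]] //= _ ->; case: b.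
    * rewrite p0 ?p1 ?pe // in hcap; case: q qe {hpass hcup} => //= _.
      by case: p pe hcap => [|a [|b []]] //= _ ->; rewrite eqxx.
    * have h01 := hpass i i.+1; have h10 := hpass i.+1 i.
      rewrite !p0 ?p1 ?pe ?qe // in h01; rewrite p0 ?p1 ?pe ?qe // in h10.
      rewrite !size_cat ri ri' pe qe in h01 h10.
      case: p q pe qe h01 h10 {hpass} => [|a [|b []]] // [|a' [|b' []]] //= _ _ h01 h10.
      by rewrite h01 ?h10 ?inE ?eqxx ?orbT //; lia.
Qed.

Lemma mem_succP a s s' : a.2 + ins a.1 <= size s ->
  size s' = step_width (size s) a ->
  s' \in succ a s <->
  [/\ forall x y, x < size s -> y < size s' -> passes a x y ->
        nth false s x = nth false s' y,
      if a.1 is Cap then nth false s a.2 = nth false s a.2.+1 else True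
    & if a.1 is Cup then nth false s' a.2 = nth false s' a.2.+1 else True].
Proof.
case: a => e i /= /split_at[r [p [t [-> ri pe]]]] ss'.
have /split_at[r' [q [t' [es' ri' qe]]]] : i + outs e <= size s'.
  by rewrite ss' /step_width !size_cat /= ri pe; lia.
have tt' : size t = size t'.
  by move: ss'; rewrite es' /step_width !size_cat /= ri pe ri' qe; lia.
rewrite es' succE //.
have -> : (r' ++ q ++ t' \in [seq r ++ q0 ++ t | q0 <- transitions e p]) =
    [&& r == r', t == t' & q \in transitions e p].
  apply/mapP/and3P => [[q0 hq0 /eqP]|[/eqP <- /eqP <- hq]]; last by exists q.
  rewrite eqseq_cat ?ri ?ri' // eqseq_cat ?qe ?(size_transitions hq0) //.
  by case/and3P=> /eqP -> /eqP -> /eqP ->.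
exact: iff_sym (rwP (passes_transitions ri pe ri' qe tt')).
Qed.

Section Coloring.
Variable w : word.
Hypothesis w_tangle : tangle 0 w 0.

Lemma width_succ k : k < size w ->
  width w k.+1 = step_width (width w k) (slice_at w k).
Proof. by move=> kw; rewrite /width (take_nth (Cup, 0)) // foldl_rcons. Qed.

Lemma width_size : width w (size w) = 0.
Proof. by rewrite /width take_size (tangle_width w_tangle). Qed.

Lemma slice_at_bound k : k < size w ->
  (slice_at w k).2 + ins (slice_at w k).1 <= width w k.
Proof.
move=> kw; move: w_tangle; rewrite -{1}(cat_take_drop k w) (drop_nth (Cup, 0)) //.
by rewrite tangle_cat /= => /and3P[].
Qed.

Lemma mem_points k i : ((k, i) \in points w) = (k <= size w) && (i < width w k).
Proof.
apply/allpairsPdep/andP => [[k' [i' []]]|[kw iw]].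
  by rewrite !mem_iota /= !add0n => kw iw [-> ->].
by exists k, i; rewrite !mem_iota.
Qed.

Definition state (c : nat -> nat -> bool) (k : nat) : bitseq := mkseq (c k) (width w k).

Definition consistent (c : nat -> nat -> bool) : Prop :=
  forall x y, x \in points w -> y \in points w -> joined w x y ->
    c x.1 x.2 = c y.1 y.2.

(** Every joined pair lies within a single slice, so consistency is tested slice by slice. *)
Lemma consistentP c : consistent c <->
  (forall k, k < size w -> state c k.+1 \in succ (slice_at w k) (state c k)).
Proof.
have bound k : k < size w ->
    (slice_at w k).2 + ins (slice_at w k).1 <= size (state c k).
  by move=> kw; rewrite size_mkseq slice_at_bound.
have sizeS k : k < size w ->
    size (state c k.+1) = step_width (size (state c k)) (slice_at w k).
  by move=> kw; rewrite !size_mkseq width_succ.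
have memP k kw := mem_succP (bound k kw) (sizeS k kw).
split=> [hc k kw|hs [k i] [l j]].
  have ab := slice_at_bound kw; have wS := width_succ kw.
  apply/(memP k kw); rewrite !size_mkseq; split=> [x y xw yw hpass||].
    rewrite !nth_mkseq //; apply: (hc (k, x) (k.+1, y)).
    + by rewrite mem_points (ltnW kw).
    + by rewrite mem_points kw.
    + by rewrite /joined kw eqxx hpass.
  1,2: case ea : (slice_at w k) ab wS => [[||s] i] //=; rewrite /step_width /= => ab wS.
    rewrite !nth_mkseq; try lia.
    apply: (hc (k, i) (k, i.+1)); rewrite ?mem_points ?(ltnW kw) //=; try lia.
    by rewrite kw !eqxx ea /turns !eqxx !orbT.
  rewrite !nth_mkseq ?wS; try lia.
  apply: (hc (k.+1, i) (k.+1, i.+1)); rewrite ?mem_points ?kw ?wS //=; try lia.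
  by rewrite !eqxx ea /turns !eqxx !orbT.
rewrite !mem_points => /andP[kw iw] /andP[lw jw] /= /or3P[].
- case/and3P=> kw' /eqP el hpass; subst l.
  have [h _ _] := (memP k kw').1 (hs k kw').
  by have := h i j; rewrite !size_mkseq !nth_mkseq //; apply.
- case/and3P=> kw' /eqP el; subst l.
  have [_ h _] := (memP k kw').1 (hs k kw').
  case ea : (slice_at w k).1 h => // h /andP[/eqP ei /eqP ej].
  by move: h; rewrite -ei in ej *; subst j; rewrite !nth_mkseq.
- case: k kw iw => // k kw iw /and3P[_ /eqP el]; subst l.
  have [_ _ h] := (memP k kw).1 (hs k kw).
  rewrite /= in h *; case ea : (slice_at w k).1 h => // h /andP[/eqP ei /eqP ej].
  by move: h; rewrite -ei in ej *; subst j; rewrite !nth_mkseq.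
Qed.

End Coloring.

Section Components.
Variable D : diagram.

Let D_tangle : tangle 0 D 0.
Proof. by case/andP: (diagramP D). Qed.

Let T := seq_sub (points D).

Let color (A : {set T}) (k i : nat) : bool :=
  if insub (k, i) is Some z then (z : T) \in A else false.

Let colorE A (z : T) : color A (val z).1 (val z).2 = (z \in A).
Proof. by rewrite /color -surjective_pairing valK. Qed.

(** Level 0 is omitted as in [runs]; it carries no points, so nothing is lost. *)
Let run_of (A : {set T}) : seq bitseq :=
  [seq state D (color A) k | k <- iota 1 (size (D : word))].

Let state_ge1 (z : T) : 0 < (val z).1.
Proof.
by case: z => [[[|k] i] h] //=; have := h; rewrite mem_points /width take0 andbF.
Qed.

Let run_of_inj : injective run_of.
Proof.
move=> A B /eq_in_map AB; apply/setP=> z; rewrite -!colorE.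
have := valP z; rewrite [val z]surjective_pairing mem_points => /andP[zk zi].
have /(congr1 (fun s => nth false s (val z).2)) :
    state D (color A) (val z).1 = state D (color B) (val z).1.
  by apply: AB; rewrite mem_iota state_ge1 add1n ltnS.
by rewrite !nth_mkseq.
Qed.

Let nth_run_of A k : k <= size (D : word) ->
  nth [::] ([::] :: run_of A) k = state D (color A) k.
Proof.
case: k => [|k] kD /=; first by rewrite /state /width take0.
by rewrite (nth_map 0) ?size_iota // nth_iota.
Qed.

Let color_sets := [set A : {set T} |
  [forall x : T, forall y : T,
     (joined D (val x) (val y) || joined D (val y) (val x)) ==> ((x \in A) == (y \in A))]].

Let color_setsP A : reflect (consistent D (color A)) (A \in color_sets).
Proof.
rewrite inE; apply: (iffP forallP) => [h x y xD yD xy|h x].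
  have /forallP/(_ (SeqSub yD))/implyP := h (SeqSub xD).
  by rewrite /= xy => /(_ isT)/eqP; rewrite -!colorE.
apply/forallP=> y; apply/implyP=> /orP[] xy; apply/eqP; rewrite -!colorE.
  exact: h (valP x) (valP y) xy.
by apply/esym; apply: h (valP y) (valP x) xy.
Qed.

Theorem coloring_count_components : coloring_count D = 2 ^ components D.
Proof.
rewrite /components -card_component_sets; last by move=> x y /=; rewrite orbC.
rewrite -/color_sets cardE -(size_map run_of) /coloring_count -size_runs.
apply/perm_size/uniq_perm; first exact: uniq_runs.
  by rewrite map_inj_uniq ?enum_uniq.
move=> p; rewrite mem_runs; apply/and3P/mapP => [[/eqP sp /allP hp _]|[A]].
  (* The set is read off from the run; the prefix [[::]] restores level 0. *)
  pose A := [set z : T | nth false (nth [::] ([::] :: p) (val z).1) (val z).2].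
  have hw k : k <= size (D : word) -> size (nth [::] ([::] :: p) k) = width D k.
    elim: k => [|k IH] kD; first by rewrite /width take0.
    have ab := slice_at_bound D_tangle kD.
    have := hp k; rewrite mem_iota add0n => /(_ kD) /size_succ.
    by rewrite IH ?(ltnW kD) // => /(_ ab) ->; rewrite width_succ.
  have hstate k : k <= size (D : word) -> state D (color A) k = nth [::] ([::] :: p) k.
    move=> kD; apply: (@eq_from_nth _ false); rewrite size_mkseq ?hw // => i iw.
    have kiD : (k, i) \in points D by rewrite mem_points kD.
    by rewrite nth_mkseq //; have := colorE A (SeqSub kiD); rewrite /= inE.
  exists A.
    rewrite mem_enum; apply/color_setsP/consistentP => // k kD.
    rewrite !hstate ?(ltnW kD) //; apply: hp; by rewrite mem_iota.
  apply: (@eq_from_nth _ [::]); first by rewrite size_map size_iota.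
  move=> k kp; rewrite sp in kp; have := nth_run_of A kp; rewrite hstate //=.
rewrite mem_enum => /color_setsP /consistentP hA ->; split.
- by rewrite size_map size_iota.
- apply/allP=> k; rewrite mem_iota add0n => /= kD.
  have := hA D_tangle k kD.
  by rewrite -(nth_run_of A kD) -(nth_run_of A (ltnW kD)).
- rewrite (last_nth [::]) size_map size_iota nth_run_of // /nilp size_mkseq.
  by rewrite width_size.
Qed.

End Components.

(** * Components and moves *)

Lemma diagram_tangle (D : diagram) : tangle 0 D 0.
Proof. by case/andP: (diagramP D). Qed.

Lemma diagram_of w : w <> [::] -> tangle 0 w 0 -> exists D : diagram, D = w :> word.
Proof.
move=> w0 hw; have Dw : ~~ nilp w && tangle 0 w 0 by rewrite hw andbT; case: (w) w0.
by exists (Diagram Dw).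
Qed.

Lemma nonempty_of_width u v n : 0 < n -> tangle 0 u n -> u ++ v <> [::].
Proof. by case: u => //= n0 /eqP en; rewrite -en in n0. Qed.

Lemma elementary_source t t' : elementary t t' -> t <> [::].
Proof. by case=> {t t'} [? ? []|? ? []|? ? []|[]]. Qed.

(** A move that erases its source needs an existing strand, so no move turns a closed diagram into
    the empty word. *)
Lemma elementary_nil t : elementary t [::] -> ~~ tangle 0 t 0.
Proof.
move e: [::] => t' h; case: h e => {t t'} [t t' []|t t' []|t t' []|[] s i] //= *;
  by tangle_lia.
Qed.

Lemma sim_local (R : word -> word -> Prop) (D D' : diagram) :
  (forall t t', R t t' -> elementary t t') -> local_move R D D' -> sim 0 0 D D'.
Proof.
move=> sub_R [u [t [t' [v [tt' eD eD']]]]]; apply: rst_step.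
by split; [exact: diagram_tangle|exact: diagram_tangle|exists u, t, t', v; split; auto].
Qed.

Lemma sim_regular D D' : regular_isotopic D D' -> sim 0 0 D D'.
Proof.
elim=> [x y []|x|x y _|x y z _ h1 _ h2].
- by apply: sim_local; apply: elementary_planar.
- by apply: sim_local; apply: elementary_R2.
- by apply: sim_local; apply: elementary_R3.
- exact: rst_refl.
- exact: rst_sym.
- exact: rst_trans h1 h2.
Qed.

Lemma planar_regular D D' : planar_isotopic D D' -> regular_isotopic D D'.
Proof.
elim=> [x y h|x|x y _|x y z _ h1 _ h2]; last exact: rst_trans h1 h2.
- by apply: rst_step; constructor.
- exact: rst_refl.
- exact: rst_sym.
Qed.

Lemma sim_drawn D w : drawn_as D w -> sim 0 0 D w.
Proof. by case=> E DE <-; apply/sim_regular/planar_regular. Qed.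

Lemma drawn_refl (D : diagram) w : D = w :> word -> drawn_as D w.
Proof. by move=> Dw; exists D => //; apply: rst_refl. Qed.

Lemma components_eq (D D' : diagram) :
  coloring_count D = coloring_count D' -> components D = components D'.
Proof. by rewrite !coloring_count_components => /expnI; apply. Qed.

Lemma components_sim (D D' : diagram) : sim 0 0 D D' -> components D = components D'.
Proof. by move/coloring_count_sim/components_eq. Qed.

Lemma components_smoothing (D D' : diagram) u v i s :
  D = u ++ [:: (Cross s, i)] ++ v :> word ->
  D' = u ++ v :> word \/ D' = u ++ [:: (Cap, i); (Cup, i)] ++ v :> word ->
  components D' <= (components D).+1.
Proof.
move=> eD eD'; rewrite -(@leq_exp2l 2) // expnS -!coloring_count_components.
have hD := diagram_tangle D; rewrite eD in hD *.
by case: eD' => ->; [apply: coloring_count_vertical|apply: coloring_count_horizontal].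
Qed.

Lemma components_circle (D D' : diagram) u v n : tangle 0 u n ->
  D = u ++ v :> word -> D' = u ++ [:: (Cup, n); (Cap, n)] ++ v :> word ->
  components D' = (components D).+1.
Proof.
move=> hu eD eD'; apply: (@expnI 2) => //.
rewrite expnS -!coloring_count_components eD eD' /coloring_count !colorings_cat.
have -> : 2 * colorings u (colorings v closed_weight) [::] =
    colorings u (fun s => colorings v closed_weight s + colorings v closed_weight s) [::].
  by rewrite colorings_add addnn mul2n.
apply: eq_colorings hu _ _ => // s sn.
by rewrite colorings_cat colorings_circle // mul2n addnn.
Qed.

Lemma components_crossing_change (D D' : diagram) u v i s t :
  D = u ++ [:: (Cross s, i)] ++ v :> word ->
  D' = u ++ [:: (Cross t, i)] ++ v :> word -> components D = components D'.
Proof.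
by move=> eD eD'; apply: components_eq; rewrite eD eD' /coloring_count !colorings_cat.
Qed.

Lemma components_O : components O_diagram = 1.
Proof.
apply: (@expnI 2) => //; rewrite -coloring_count_components.
by rewrite /coloring_count (colorings_circle [::]).
Qed.

Lemma adds_kink_sim s D D' : adds_kink s D D' -> sim 0 0 D' D.
Proof.
case=> u [v [i [right [hD hD']]]].
apply: rst_trans (sim_drawn hD') _; apply: rst_trans _ (rst_sym _ _ _ _ (sim_drawn hD)).
case: hD hD' => E _ eE [E' _ eE']; apply: rst_step; split.
- by rewrite -eE' diagram_tangle.
- by rewrite -eE diagram_tangle.
- by exists u, (curl right s i), [::], v; split=> //; apply: elementary_curl.
Qed.

Local Open Scope ring_scope.
Import Order.TTheory GRing.Theory Num.Theory.

(** * Vanishing of the negative coefficients *)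

Section Vanishing.
Variables (R : comNzRingType) (iota : {rmorphism Zlaurent -> R}).
Variable alpha : int -> diagram -> R.
Hypothesis alpha_planar : forall (n : int) (D D' : diagram),
  planar_isotopic D D' -> alpha n D = alpha n D'.
Hypothesis alpha_R2 : forall (n : int) (D D' : diagram),
  local_move reidemeister2 D D' -> alpha n D = alpha n D'.
Hypothesis alpha_R3 : forall (n : int) (D D' : diagram),
  local_move reidemeister3 D D' -> alpha n D = alpha n D'.
Hypothesis alpha_kink_pos : forall (n : int) (D D' : diagram),
  adds_kink true D D' -> alpha n D' = iota Zy * alpha n D.
Hypothesis alpha_kink_neg : forall (n : int) (D D' : diagram),
  adds_kink false D D' -> alpha n D' = iota ZyV * alpha n D.
Hypothesis alpha_O : forall n : int, alpha n O_diagram = (n == 0)%:R.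
Hypothesis alpha_skein : forall (n : int) (Dp Dm Doo D0 : diagram),
  skein_quadruple Dp Dm Doo D0 ->
  alpha n Dp + alpha n Dm =
    alpha (n + Delta Dp Doo - 1) Doo + alpha (n + Delta Dp D0 - 1) D0.

Lemma iota_ZyK : iota Zy * iota ZyV = 1.
Proof. by rewrite -rmorphM ZyK rmorph1. Qed.

Lemma alpha_regular n D D' : regular_isotopic D D' -> alpha n D = alpha n D'.
Proof.
elim=> [x y []|x|x y _|x y z _ -> _ ->] //.
- by move=> xy; apply/alpha_planar/rst_step.
- exact: alpha_R2.
- exact: alpha_R3.
Qed.

(** The factor c is a unit, with inverse d, and is the same for all n: it is 1, or a power of y for
    a curl. Hence vanishing is transported in both directions. *)
Lemma alpha_elementary (D D' : diagram) u t t' v : elementary t t' ->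
  D = u ++ t ++ v :> word -> D' = u ++ t' ++ v :> word ->
  exists c d : R, c * d = 1 /\ forall n, alpha n D = c * alpha n D'.
Proof.
move=> tt' eD eD'.
have move_of (P : word -> word -> Prop) : P t t' -> local_move P D D'.
  by move=> h; exists u, t, t', v.
case: tt' eD eD' move_of => {t t'} [t t' h|t t' h|t t' h|right s i] eD eD' move_of.
- exists 1, 1; split=> [|n]; rewrite mul1r //.
  by apply: alpha_planar; apply: rst_step; apply: move_of.
- by exists 1, 1; split=> [|n]; rewrite mul1r //; apply/alpha_R2/move_of.
- by exists 1, 1; split=> [|n]; rewrite mul1r //; apply/alpha_R3/move_of.
have kink : adds_kink s D' D.
  by exists u, v, i, right; split; apply: drawn_refl.
case: s kink {eD move_of} => kink.
  by exists (iota Zy), (iota ZyV); split=> [|n]; [exact: iota_ZyK|exact: alpha_kink_pos].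
exists (iota ZyV), (iota Zy); split=> [|n]; [by rewrite mulrC iota_ZyK|exact: alpha_kink_neg].
Qed.

(** Holds vacuously for words that are not diagrams, in particular for the empty word. *)
Definition vanishes (w : word) : Prop :=
  forall (D : diagram) (n : int), D = w :> word -> n < 0 -> alpha n D = 0.

Lemma vanishes_rewrites w w' : rewrites 0 0 w w' -> vanishes w <-> vanishes w'.
Proof.
move=> [hw hw' [u [t [t' [v [tt' ew ew']]]]]].
have w0 : w <> [::].
  by move: (elementary_source tt'); rewrite ew; case: (u) => //; case: (t).
have w'0 : w' <> [::].
  rewrite ew'; case eu: u => //; case et: t' => //; case ev: v => // _.
  rewrite et in tt'; move/negP: (elementary_nil tt'); apply.
  by move: hw; rewrite ew eu ev cats0.
split=> van D n eD n0.
  have [E eE] := diagram_of w0 hw.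
  have [c [d [cd h]]] := alpha_elementary tt' (etrans eE ew) (etrans eD ew').
  by rewrite -[alpha n D]mul1r -cd mulrAC -h (van E n eE n0) mul0r.
have [E eE] := diagram_of w'0 hw'.
have [c [d [cd h]]] := alpha_elementary tt' (etrans eD ew) (etrans eE ew').
by rewrite h (van E n eE n0) mulr0.
Qed.

Lemma vanishes_sim w w' : sim 0 0 w w' -> vanishes w' -> vanishes w.
Proof.
move=> ww'; suff [] : vanishes w <-> vanishes w' by [].
elim: ww' => [x y /vanishes_rewrites|x|x y _ []|x y z _ [h1 h2] _ [h3 h4]] //.
by split=> h; auto.
Qed.

Lemma vanishes_skein u v i s :
  tangle 0 (u ++ [:: (Cross s, i)] ++ v) 0 ->
  vanishes (u ++ [:: (Cross (~~ s), i)] ++ v) -> vanishes (u ++ v) ->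
  vanishes (u ++ [:: (Cap, i); (Cup, i)] ++ v) ->
  vanishes (u ++ [:: (Cross s, i)] ++ v).
Proof.
move=> hX vX vV vH D n eD n0.
have [k hu] : exists2 k, tangle 0 u k & tangle k ([:: (Cross s, i)] ++ v) 0.
  exact/tangle_catP.
move=> /= /andP[/= ik hv].
have hv' : tangle k v 0 by move: hv; rewrite /step_width /= subnK //; lia.
have k0 : (0 < k)%N by lia.
have [D1 e1] : exists D1 : diagram, D1 = u ++ [:: (Cross (~~ s), i)] ++ v :> word.
  apply: diagram_of (nonempty_of_width k0 hu) _; apply/tangle_catP; exists k => //=.
  by rewrite ik.
have [D2 e2] : exists D2 : diagram, D2 = u ++ v :> word.
  by apply: diagram_of (nonempty_of_width k0 hu) _; apply/tangle_catP; exists k.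
have [D3 e3] : exists D3 : diagram, D3 = u ++ [:: (Cap, i); (Cup, i)] ++ v :> word.
  apply: diagram_of (nonempty_of_width k0 hu) _; apply/tangle_catP; exists k => //=.
  by rewrite ik /step_width /= subn0 !addn0 subnK ?hv' ?andbT //; lia.
have quad : skein_quadruple D D1 D2 D3.
  by exists u, v, i, s; split; [| |left; split]; apply: drawn_refl.
(* As [Delta] is at most 1 for both smoothings, the indices n + [Delta] - 1 are at most n, hence
   negative. *)
have c2 := components_smoothing eD (or_introl e2).
have c3 := components_smoothing eD (or_intror e3).
have := alpha_skein n quad.
rewrite (vX D1) // (vV D2) //; last by rewrite /Delta; lia.
rewrite (vH D3) //; last by rewrite /Delta; lia.
by rewrite !addr0.
Qed.

(* The circle is a smoothing of a kink on the strand to its left; the other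
   smoothing removes the kink. *)
Lemma vanishes_circle u v n : (0 < n)%N -> tangle 0 u n -> tangle n v 0 ->
  vanishes (u ++ v) -> vanishes (u ++ [:: (Cup, n); (Cap, n)] ++ v).
Proof.
case: n => // n _ hu hv van D k eD k0.
have diagram_with t : tangle n.+1 t n.+1 -> exists E : diagram, E = u ++ t ++ v :> word.
  move=> ht; apply: diagram_of (nonempty_of_width _ hu) _ => //.
  by apply/tangle_catP; exists n.+1 => //; apply/tangle_catP; exists n.+1.
have [E eE] := diagram_with [::] (eqxx _).
have [Ep eEp] : exists Ep : diagram, Ep = u ++ curl true true n ++ v :> word.
  by apply: diagram_with; tangle_lia.
have [Em eEm] : exists Em : diagram, Em = u ++ curl true false n ++ v :> word.
  by apply: diagram_with; tangle_lia.
have [Eh eEh] : exists Eh : diagram,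
    Eh = u ++ [:: (Cup, n.+1); (Cap, n); (Cup, n); (Cap, n.+1)] ++ v :> word.
  by apply: diagram_with; tangle_lia.
have quad : skein_quadruple Ep Em D Eh.
  exists (u ++ [:: (Cup, n.+1)]), ((Cap, n.+1) :: v), n, true.
  by split; [| |left; split]; apply: drawn_refl; rewrite -catA.
have Eh_sim : sim 0 0 Eh E.
  rewrite eEh eE; apply: sim_cat hu hv _.
  have h : conv [:: (Cup, n.+1); (Cap, n); (Cup, n); (Cap, n.+1)] [::].
    apply: conv_trans (conv_zigzag_left n).
    exact: (conv_catr [:: (Cup, n); (Cap, n.+1)] (conv_zigzag_right n)).
  by case: h; apply; tangle_lia.
have kink s (F : diagram) : F = u ++ curl true s n ++ v :> word -> sim 0 0 F E.
  move=> eF; rewrite eF eE; apply: sim_cat hu hv _.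
  by case: (conv_curl s n true); apply; tangle_lia.
have van_sim (F : diagram) : sim 0 0 F E -> vanishes F.
  by move=> h; apply: vanishes_sim h _; rewrite eE.
(* D has one component more than the kinked diagrams, so it enters the skein relation with index k
   itself; the straightened smoothing [Eh] enters with index k - 1. *)
have cD := components_circle hu eE eD.
have := alpha_skein k quad.
rewrite (van_sim _ (kink _ _ eEp) Ep) // (van_sim _ (kink _ _ eEm) Em) //.
rewrite (van_sim _ Eh_sim Eh) //; last first.
  rewrite /Delta (components_sim Eh_sim) (components_sim (kink _ _ eEp)); lia.
rewrite !addr0 /Delta cD (components_sim (kink _ _ eEp)).
by have -> : k + ((components E).+1%:Z - (components E)%:Z) - 1 = k by lia.
Qed.

Lemma vanishes_closed : skein_closed vanishes.
Proof.
split; [exact: vanishes_sim|exact: vanishes_skein|exact: vanishes_circle| |].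
- by move=> D n eD; have := diagramP D; rewrite eD.
- move=> D n eD n0; have -> : D = O_diagram by apply: val_inj.
  by rewrite alpha_O lt_eqF.
Qed.

Theorem alpha_negative n D : n < 0 -> alpha n D = 0.
Proof. exact: (skein_closed_all vanishes_closed (diagram_tangle D)). Qed.

End Vanishing.

(** * Coefficients of the series [L] *)

Section Series.
Variables (R : comNzRingType) (alpha : int -> diagram -> R).
Hypothesis alpha_negative : forall n D, n < 0 -> alpha n D = 0.

(** The terms cut off by the truncation are zero, so the formula holds for every k. *)
Lemma L_coef D (k : int) : L alpha D k = alpha (k - (1 - (components D)%:Z)) D.
Proof. by rewrite /=; case: (k - _) => // m; rewrite alpha_negative. Qed.

Lemma L_skein Dp Dm Doo D0 : skein_quadruple Dp Dm Doo D0 ->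
  (forall n, alpha n Dp + alpha n Dm =
    alpha (n + Delta Dp Doo - 1) Doo + alpha (n + Delta Dp D0 - 1) D0) ->
  L alpha Dp + L alpha Dm = zmul 1 (L alpha Doo + L alpha D0).
Proof.
move=> quad skein; apply: lseriesP => k.
have cm : components Dm = components Dp.
  case: quad => u [v [i [s [hp hm _]]]].
  case: (hp) (hm) => Ep _ ep [Em _ em].
  rewrite (_ : components Dm = components Em); last first.
    by apply: components_sim; rewrite em; apply: sim_drawn.
  rewrite (_ : components Dp = components Ep); last first.
    by apply: components_sim; rewrite ep; apply: sim_drawn.
  exact: components_crossing_change em ep.
rewrite -[LHS]/(L alpha Dp k + L alpha Dm k).
rewrite -[RHS]/(L alpha Doo (k - 1) + L alpha D0 (k - 1)) !L_coef cm.
(* With n = k - 1 + r(Dp), the component count of Dp cancels in n + [Delta] - 1, leaving the index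
   of the coefficient of degree k - 1 for the smoothing. *)
rewrite skein; congr (alpha _ _ + alpha _ _); rewrite /Delta; lia.
Qed.

Lemma L_kink c D D' : components D = components D' ->
  (forall n, alpha n D' = c * alpha n D) -> L alpha D' = c *: L alpha D.
Proof.
move=> cD h; apply: lseriesP => k.
by rewrite -[RHS]/(c * L alpha D k) !L_coef cD h.
Qed.

End Series.

Theorem proposition4p7 (R : comNzRingType)
  (iota : {rmorphism Zlaurent -> R}) (iota_inj : injective iota)
  (alpha : int -> diagram -> R)
  (alpha_planar : forall (n : int) (D D' : diagram),
     planar_isotopic D D' -> alpha n D = alpha n D')
  (alpha_R2 : forall (n : int) (D D' : diagram),
     local_move reidemeister2 D D' -> alpha n D = alpha n D')
  (alpha_R3 : forall (n : int) (D D' : diagram),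
     local_move reidemeister3 D D' -> alpha n D = alpha n D')
  (alpha_kink_pos : forall (n : int) (D D' : diagram),
     adds_kink true D D' -> alpha n D' = iota Zy * alpha n D)
  (alpha_kink_neg : forall (n : int) (D D' : diagram),
     adds_kink false D D' -> alpha n D' = iota ZyV * alpha n D)
  (alpha_O : forall n : int, alpha n O_diagram = (n == 0)%:R)
  (alpha_skein : forall (n : int) (Dp Dm Doo D0 : diagram),
     skein_quadruple Dp Dm Doo D0 ->
     alpha n Dp + alpha n Dm =
       alpha (n + Delta Dp Doo - 1) Doo + alpha (n + Delta Dp D0 - 1) D0) :
  [/\ forall D D' : diagram, regular_isotopic D D' -> L alpha D = L alpha D',
      forall Dp Dm Doo D0 : diagram, skein_quadruple Dp Dm Doo D0 ->
        L alpha Dp + L alpha Dm = zmul 1 (L alpha Doo + L alpha D0),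
      forall D D' : diagram, adds_kink true D D' ->
        L alpha D' = iota Zy *: L alpha D,
      forall D D' : diagram, adds_kink false D D' ->
        L alpha D' = iota ZyV *: L alpha D
    & L alpha O_diagram = lone R].
Proof.
have negative n D : n < 0 -> alpha n D = 0 by apply: (alpha_negative (iota := iota)).
have coef := L_coef negative.
split.
- move=> D D' DD'; apply: lseriesP => k; rewrite !coef.
  by rewrite (components_sim (sim_regular DD')); apply: alpha_regular.
- by move=> Dp Dm Doo D0 quad; apply: L_skein => // n; apply: alpha_skein.
- move=> D D' DD'; apply: L_kink => // [|n]; last exact: alpha_kink_pos.
  exact/esym/components_sim/adds_kink_sim/DD'.
- move=> D D' DD'; apply: L_kink => // [|n]; last exact: alpha_kink_neg.
  exact/esym/components_sim/adds_kink_sim/DD'.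
- apply: lseriesP => k; rewrite coef components_O subrr subr0 alpha_O.
  by case: k.
Qed.
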